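(* Let $d\ge 1$, let $\gamma,p\in\mathbb{R}$ with $\gamma+2p<1$, and let $0<c_1\le c_2<\infty$. Suppose that $K:\mathbb{R}^d_*\times\mathbb{R}^d_*\to\mathbb{R}_+$ is continuous, homogeneous with homogeneity $\gamma$ (i.e. $K(\lambda x,\lambda y)=\lambda^\gamma K(x,y)$ for all $\lambda>0$), and satisfies $$c_1(|x|+|y|)^{\gamma}\,\Phi\!\left(\tfrac{|x|}{|x|+|y|}\right)\le K(x,y)\le c_2(|x|+|y|)^{\gamma}\,\Phi\!\left(\tfrac{|x|}{|x|+|y|}\right),\qquad x,y\in\mathbb{R}^d_*,$$ where $\Phi(s)=s^{-p}(1-s)^{-p}$ for $0<s<1$. Let $\theta_0\in\Delta^{d-1}$ and $C_0>0$ be arbitrary, and let $f\in\mathcal{M}_+(\mathbb{R}^d_* )$ be the measure whose representation in the coordinates $r=|x|$, $\theta=x/|x|$ is $$F(r,\theta)=\frac{C_0}{r^{\frac{\gamma+1}{2}+d}}\,\delta(\theta-\theta_0),$$ that is, $\int\varphi(x)f(dx)=\frac{C_0}{\sqrt d}\int_0^\infty\varphi(r\theta_0)\,r^{-\frac{\gamma+3}{2}}\,dr$ for all $\varphi\in C_c(\mathbb{R}^d_* )$. Then $f$ is a non-trivial constant flux solution with kernel $K$ and parameters $(\gamma,p)$.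
   Context: Notation: $\mathbb{R}_+=[0,\infty)$, $O=(0,\dots,0)$, $\mathbb{R}^d_*=\mathbb{R}_+^d\setminus\{O\}$, $\mathbb{R}_*=(0,\infty)$, $|x|=\sum_{j=1}^d x_j$ (the $\ell^1$-norm). $\mathcal{M}_+(X)$ denotes the non-negative Radon measures on $X$ (not necessarily bounded). $C_c$, $C^1_c$ denote continuous, respectively $C^1$, compactly supported functions. $\Delta^{d-1}=\{\theta\in\mathbb{R}^d_*:|\theta|=1\}$ with surface area element $d\tau(\theta)$; the Dirac measure $\delta(\theta-\theta_0)$ is normalized so that $\int_{\Delta^{d-1}}g(\theta)\delta(\theta-\theta_0)d\tau(\theta)=g(\theta_0)$. To $f\in\mathcal{M}_+(\mathbb{R}^d_* )$ one associates $F\in\mathcal{M}_+(\mathbb{R}_*\times\Delta^{d-1})$ defined by $\int\psi(r,\theta)\frac{r^{d-1}}{\sqrt d}F(r,\theta)\,dr\,d\tau(\theta)=\int\psi(|x|,x/|x|)f(dx)$ for all $\psi\in C_c(\mathbb{R}_*\times\Delta^{d-1})$. Definition (constant flux solution with kernel $K$, parameters $(\gamma,p)$). A measure $f\in\mathcal{M}_+(\mathbb{R}^d_* )$ is a stationary solution (without source) if $$\int_{\{|x|\ge1\}}|x|^{\gamma+p}f(dx)+\int_{\{|x|<1\}}|x|^{1-p}f(dx)<\infty$$ and for every $\varphi\in C^1_c(\mathbb{R}^d_* )$ $$0=\frac12\int_{\mathbb{R}^d_*}\int_{\mathbb{R}^d_*}K(x,y)\,[\varphi(x+y)-\varphi(x)-\varphi(y)]\,f(dx)f(dy).$$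 Its total flux across $\{|x|=R\}$ is the vector $A(R)$, $R>0$, with components $$A_j(R)=\frac1d\int_{(0,R]\times\Delta^{d-1}}dr\,d\tau(\theta)\int_{(R-r,\infty)\times\Delta^{d-1}}d\rho\,d\tau(\sigma)\;r^d\rho^{d-1}F(r,\theta)F(\rho,\sigma)\,\theta_j\,K(r\theta,\rho\sigma).$$ Equivalently, $A_j(R)=\iint_{\{|x|\le R,\ |x|+|y|>R\}}x_jK(x,y)f(dx)f(dy)$. The measure $f$ is a non-trivial constant flux solution if it is a stationary solution and there is $J_0\in\mathbb{R}_+^d\setminus\{O\}$ such that $A(R)=J_0$ for all $R>0$. *)

(* Defs.v *)
From HB Require Import structures.
From mathcomp Require Import all_boot all_order all_algebra.
From mathcomp Require Import all_classical all_reals all_analysis.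

Set Implicit Arguments.
Unset Strict Implicit.
Unset Printing Implicit Defensive.

Import Order.TTheory GRing.Theory Num.Theory.
Import numFieldNormedType.Exports.

Local Open Scope classical_set_scope.
Local Open Scope ring_scope.

HB.instance Definition _ (T U : ptopologicalType) := Pointed.on (T * U)%type.

Notation borel T := (g_sigma_algebraType (@open T)).

(* Radon measures on X, for X a Borel, locally compact, sigma-compact subset of
   a metrizable T: a measure on X is represented by the Borel measure on T
   concentrated on X, and on such X Radon amounts to being finite on the compact
   subsets. *)
Definition radon_on (R : realType) (T : ptopologicalType) (X : set T)
    (mu : {measure set (borel T) -> \bar R}) : Prop :=
  mu (~` X) = 0%E /\
  forall C : set T, compact C -> C `<=` X -> (mu C < +oo)%E.

(* Functions on X are represented by functions on T; only their values on X
   matter. *)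
Definition compact_support_on (R : realType) (T : topologicalType) (X : set T)
    (phi : T -> R) : Prop :=
  exists C : set T,
    [/\ compact C, C `<=` X & forall x, X x -> ~ C x -> phi x = 0].

Definition Cc_on (R : realType) (T : topologicalType) (X : set T)
    (phi : T -> R) : Prop :=
  {within X, continuous phi} /\ compact_support_on X phi.

Section Space.
Variables (R : realType) (d : nat).
Implicit Types (x y theta : 'rV[R]_d).

Definition l1norm x : R := \sum_(j < d) x 0 j.

Definition Rdstar : set 'rV[R]_d :=
  [set x | (forall j, 0 <= x 0 j) /\ x <> 0].

Definition simplex : set 'rV[R]_d :=
  [set theta | Rdstar theta /\ l1norm theta = 1].

Definition polar_domain : set (R * 'rV[R]_d) :=
  [set z | 0 < z.1 /\ simplex z.2].

(* Compactly supported C^1 functions on [Rdstar]. As [Rdstar] contains boundary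
   faces, C^1 is understood on an open neighbourhood of it; the support
   condition is relative to [Rdstar], so phi need not vanish on the faces. *)
Definition C1c (phi : 'rV[R]_d -> R) : Prop :=
  (exists U : set 'rV[R]_d,
    [/\ open U, Rdstar `<=` U & forall x, U x ->
        differentiable (phi : 'rV[R]_d -> R^o) x /\
        forall j : 'I_d,
          {for x, continuous (fun z : 'rV[R]_d =>
             'D_(delta_mx 0 j) (phi : 'rV[R]_d -> R^o) z)}]) /\
  compact_support_on Rdstar phi.

Definition kernel_weight (p s : R) : R := s `^ (- p) * (1 - s) `^ (- p).

Definition stationary_solution (K : 'rV[R]_d -> 'rV[R]_d -> R) (gamma p : R)
    (f : {measure set (borel 'rV[R]_d) -> \bar R}) : Prop :=
  [/\ radon_on Rdstar f,
      (\int[f]_(x in Rdstar `&` [set x | (1 <= l1norm x)%R])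
          (l1norm x `^ (gamma + p))%:E +
       \int[f]_(x in Rdstar `&` [set x | (l1norm x < 1)%R])
          (l1norm x `^ (1 - p))%:E < +oo)%E
    & forall phi : 'rV[R]_d -> R, C1c phi ->
      (* absolute convergence of the double integral below *)
      (\int[f]_(x in Rdstar) \int[f]_(y in Rdstar)
          (K x y * `|phi (x + y) - phi x - phi y|)%:E < +oo)%E /\
      0%E = ((2^-1)%:E * \int[f]_(x in Rdstar) \int[f]_(y in Rdstar)
          (K x y * (phi (x + y) - phi x - phi y))%:E)%E].

(* F stands for the measure written F(r, theta) dr dtau(theta). *)
Definition polar_representation
    (f : {measure set (borel 'rV[R]_d) -> \bar R})
    (F : {measure set (borel (R * 'rV[R]_d)%type) -> \bar R}) : Prop :=
  radon_on polar_domain F /\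
  forall psi : R * 'rV[R]_d -> R, Cc_on polar_domain psi ->
    (\int[F]_(z in polar_domain)
        (psi z * (z.1 ^+ d.-1 / Num.sqrt d%:R))%:E =
     \int[f]_(x in Rdstar) (psi (l1norm x, (l1norm x)^-1 *: x))%:E)%E.

(* The component A_j(rho) of the total flux across {|x| = rho}, for the measure
   with polar representation F. *)
Definition total_flux (K : 'rV[R]_d -> 'rV[R]_d -> R)
    (F : {measure set (borel (R * 'rV[R]_d)%type) -> \bar R})
    (rho : R) (j : 'I_d) : \bar R :=
  ((d%:R^-1)%:E *
   \int[F]_(z in [set z | polar_domain z /\ (z.1 <= rho)%R])
     \int[F]_(w in [set w | (rho - z.1 < w.1)%R /\ simplex w.2])
       (z.1 ^+ d * w.1 ^+ d.-1 * z.2 0 j * K (z.1 *: z.2) (w.1 *: w.2))%:E)%E.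

(* Since every Radon measure on [Rdstar] has exactly one polar representation F,
   the quantifier over F only names it. *)
Definition constant_flux_solution (K : 'rV[R]_d -> 'rV[R]_d -> R) (gamma p : R)
    (f : {measure set (borel 'rV[R]_d) -> \bar R}) : Prop :=
  stationary_solution K gamma p f /\
  exists F : {measure set (borel (R * 'rV[R]_d)%type) -> \bar R},
    polar_representation f F /\
    exists2 J0 : 'rV[R]_d, Rdstar J0 &
      forall rho : R, 0 < rho -> forall j : 'I_d,
        total_flux K F rho j = (J0 0 j)%:E.

End Space.

(* Main.v *)
Require Import Defs.
From HB Require Import structures.
From mathcomp Require Import all_boot all_order all_algebra.
From mathcomp Require Import all_classical all_reals all_analysis.
From mathcomp Require Import measurable_realfun.
From mathcomp Require Import ring lra.

Set Implicit Arguments.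
Unset Strict Implicit.
Unset Printing Implicit Defensive.

Import Order.TTheory GRing.Theory Num.Theory.
Import numFieldNormedType.Exports.

Local Open Scope classical_set_scope.
Local Open Scope ring_scope.

(* Write a = (gamma + 3) / 2. As f is carried by the ray spanned by theta0, only
   kappa t = K theta0 (t theta0) matters: by homogeneity, for x = r theta0 and
   y = r t theta0 one has K x y f(dx) f(dy) = C kappa(t) t^-a r^-2 dr dt. For
   fixed t the weak formulation thus involves the integral of
   r^-2 [g((1 + t) r) - g(r) - g(t r)], where g is the test function along the ray;
   dilation by c multiplies integrals against r^-2 dr by c, and
   (1 + t) - 1 - t = 0. Fubini applies because the absolute value of that integral
   is O(min(t, 1)), g being Lipschitz with compact support in ]0, +oo[, while
   kappa(t) t^-a min(t, 1) is integrable when gamma + 2 p < 1. In the same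
   coordinates the flux across {|x| = rho} integrates dr / r over
   ]rho / (1 + t), rho], which contributes ln (1 + t) whatever rho is; the flux is
   therefore proportional to theta0 and to the integral of
   kappa(t) t^-a ln (1 + t), which is finite and positive.

   Since f is only known through its integrals of functions of C_c, it is first
   identified with the image of a density on ]0, +oo[ under the ray. *)

(** * Integration on the half-line *)

(** A single margin, (1 - gamma - 2p) / 2, controls both ends of the integral in [t]: the dominating
    exponent is -1 plus the margin at 0 and -1 minus the margin at infinity. The two moment
    conditions on [f] lead to the same exponents, and the logarithm in the flux costs only an
    arbitrarily small power, so gamma + 2p < 1 serves everywhere.

    The shape of the proof comes from measurability. [K] is continuous only relative to pairs of
    points of the orthant, and test functions are regular only near the orthant. Every integral is
    therefore carried to the half-line before any exchange. There homogeneity writes the kernel as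
    r^gamma kappa(s / r), which is jointly measurable because kappa is continuous in one variable.
    Substitutions and positive factors pass through signed integrals by way of positive and negative
    parts; absolute convergence enters at the exchange of [r] and [t].

    The polar measure [F] is constructed from its density C0 r^-b on the half-line {(r, theta0)}.
    With b = (gamma + 1) / 2 + d one has b - (d - 1) = a, which is why the weight r^(d - 1) gives
    back [f]. *)

Section integration_on_R.
Context {R : realType}.
Local Notation mu := (@lebesgue_measure R).
Implicit Types (c : R) (h : R -> \bar R).
Local Notation P := (`]0%R, +oo[%classic : set R).
Local Open Scope ereal_scope.

Let scale c (x : R) : measurableTypeR R := (c * x)%R.

Let measurable_scale c : measurable_fun setT (scale c).
Proof. by apply: measurable_funM. Qed.

(** Uniqueness of Lebesgue measure: [c] times the image of [mu] under the dilation agrees with [mu]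
    on the intervals []a, b]]. *)
Lemma lebesgue_measure_scale c (A : set R) : (0 < c)%R -> measurable A ->
  mu A = c%:E * mu (( *%R c) @^-1` A).
Proof.
move=> c0 mA; have c0' := ltW c0.
pose m :=
  mscale (NngNum c0') (measure_function_pushforward__canonical__measure_function_Measure mu (measurable_scale c)).
suff -> : mu A = m A by [].
apply: lebesgue_measure_unique mA => /= _ [[a b]] _ <-/=.
rewrite /m /mscale /pushforward/=.
have SE : scale c @^-1` `]a, b] = `](a / c)%R, (b / c)%R]%classic.
  by apply/seteqP; split=> x /=; rewrite /scale !in_itv/= ltr_pdivrMr// ler_pdivlMr// mulrC.
transitivity (c%:E * mu `](a / c)%R, (b / c)%R]%classic); last by rewrite -SE.
rewrite !lebesgue_measure_itv/= !lte_fin ltr_pM2r ?invr_gt0//.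
case: ifPn => _; last by rewrite mule0.
by rewrite -!EFinB -EFinM; congr EFin; field; rewrite gt_eqF.
Qed.

Lemma ge0_integral_scale c h : (0 < c)%R -> measurable_fun P h ->
  (forall x, P x -> 0 <= h x) ->
  \int[mu]_(x in P) h x = \int[mu]_(x in P) (c%:E * h (c * x)%R).
Proof.
move=> c0 mh h0; have c0' := ltW c0.
have PE : scale c @^-1` P = P.
  by apply/seteqP; split=> x /=; rewrite /scale !in_itv/= !andbT pmulr_rgt0.
pose m : measure _ R :=
  mscale (NngNum c0') (measure_function_pushforward__canonical__measure_function_Measure mu (measurable_scale c)).
rewrite (@eq_measure_integral _ _ _ _ m); last first.
  by move=> A mA _; exact: (lebesgue_measure_scale c0 mA).
rewrite ge0_integral_mscale//.
rewrite (_ : integral _ _ _ = \int[mu]_(x in scale c @^-1` P) (h \o scale c) x); last first.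
  apply: ge0_integral_pushforward => //; first exact: measurable_scale.
  by move=> x /[!inE] /h0.
rewrite PE ge0_integralZl//=.
- apply: (measurable_comp (F := P)) => //.
  by move=> _ [x /= + <-]; rewrite !in_itv/= !andbT => x0; rewrite /scale mulr_gt0.
- by move=> x /=; rewrite !in_itv/= !andbT => x0; apply: h0; rewrite /= in_itv/= andbT mulr_gt0.
Qed.

(** A factor [c > 0] commutes with positive and negative parts, so the nonnegative case applies to
    each part, whether or not [h] is integrable. *)
Lemma integral_scale c h : (0 < c)%R -> measurable_fun P h ->
  \int[mu]_(x in P) h x = \int[mu]_(x in P) (c%:E * h (c * x)%R).
Proof.
move=> c0 mh; rewrite integralE (ge0_integral_scale c0 (measurable_funepos mh))//.
rewrite (ge0_integral_scale c0 (measurable_funeneg mh))//.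
rewrite [RHS]integralE; congr (_ - _); apply: eq_integral => x _.
  by rewrite -[RHS]/((fun x : R => c%:E * h (c * x)%R)^\+ x) (ge0_funeposM _ (ltW c0)) !funeposE.
by rewrite -[RHS]/((fun x : R => c%:E * h (c * x)%R)^\- x) (ge0_funenegM _ (ltW c0)) !funenegE.
Qed.

End integration_on_R.

(** * Exchange of integrals over a measurable rectangle *)

Section iterated_integrals.
Local Open Scope ereal_scope.
Context d1 d2 (X : measurableType d1) (Y : measurableType d2) (R : realType).
Variables (m1 : {sigma_finite_measure set X -> \bar R}).
Variables (m2 : {sigma_finite_measure set Y -> \bar R}).
Variables (D : set X) (E : set Y).
Hypotheses (mD : measurable D) (mE : measurable E).
Variable H : X -> Y -> \bar R.
Hypothesis mH : measurable_fun (D `*` E) (fun z => H z.1 z.2).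

(** Extension by zero turns iterated integrals over [D] and [E] into integrals over the whole
    spaces. *)
Let H' := (fun z => H z.1 z.2) \_ (D `*` E).

Let mH' : measurable_fun setT H'.
Proof. by apply/(measurable_restrictT _ _).1 => //; exact: measurableX. Qed.

Let H'_ge0 : (forall x y, D x -> E y -> 0 <= H x y) -> forall z, 0 <= H' z.
Proof. by move=> H0 z; apply: erestrict_ge0 => -[x y] [] /H0; exact. Qed.

Let patchl x : \int[m2]_y H' (x, y) = ((fun x => \int[m2]_(y in E) H x y) \_ D) x.
Proof.
rewrite patchE; case: ifPn => [/set_mem Dx|/negP Dx].
  rewrite [RHS]integral_mkcond; apply: eq_integral => y _; rewrite /H' !patchE.
  have [yE|yE] := boolP (y \in E); first by rewrite mem_set//; split => //; exact/set_mem.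
  by rewrite memNset// => -[_ /mem_set]; exact/negP.
by rewrite integral0_eq// => y _; rewrite /H' patchE memNset// => -[/= /mem_set].
Qed.

Let patchr y : \int[m1]_x H' (x, y) = ((fun y => \int[m1]_(x in D) H x y) \_ E) y.
Proof.
rewrite patchE; case: ifPn => [/set_mem Ey|/negP Ey].
  rewrite [RHS]integral_mkcond; apply: eq_integral => x _; rewrite /H' !patchE.
  have [xD|xD] := boolP (x \in D); first by rewrite mem_set//; split => //; exact/set_mem.
  by rewrite memNset// => -[/= /mem_set]; rewrite (negbTE xD).
by rewrite integral0_eq// => x _; rewrite /H' patchE memNset// => -[/= _ /mem_set].
Qed.

Lemma tonelli_on : (forall x y, D x -> E y -> 0 <= H x y) ->
  \int[m1]_(x in D) \int[m2]_(y in E) H x y =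
  \int[m2]_(y in E) \int[m1]_(x in D) H x y.
Proof.
move=> H0; rewrite [LHS]integral_mkcond [RHS]integral_mkcond.
transitivity (\int[m1]_x \int[m2]_y H' (x, y)).
  by apply: eq_integral => x _; rewrite patchl.
transitivity (\int[m2]_y \int[m1]_x H' (x, y)); last first.
  by apply: eq_integral => x _; rewrite patchr.
exact: (@fubini_tonelli _ _ _ _ _ m1 m2 _ mH' (H'_ge0 H0)).
Qed.

Lemma measurable_tonelli_on : (forall x y, D x -> E y -> 0 <= H x y) ->
  measurable_fun D (fun x => \int[m2]_(y in E) H x y).
Proof.
move=> H0; apply/(measurable_restrictT _ _).2 => //.
rewrite (_ : _ \_ _ = fun x => \int[m2]_y H' (x, y)); last first.
  by apply/funext => x; rewrite patchl.
exact: (measurable_fun_fubini_tonelli_F _ mH' (H'_ge0 H0)).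
Qed.

Lemma fubini_on :
  \int[m1]_(x in D) \int[m2]_(y in E) `|H x y| < +oo ->
  \int[m1]_(x in D) \int[m2]_(y in E) H x y =
  \int[m2]_(y in E) \int[m1]_(x in D) H x y.
Proof.
move=> Hoo; rewrite [LHS]integral_mkcond [RHS]integral_mkcond.
transitivity (\int[m1]_x \int[m2]_y H' (x, y)).
  by apply: eq_integral => x _; rewrite patchl.
transitivity (\int[m2]_y \int[m1]_x H' (x, y)); last first.
  by apply: eq_integral => x _; rewrite patchr.
suff : (m1 \x m2).-integrable setT H' by exact: Fubini.
apply/integrable12ltyP; first exact: mH'.
move: Hoo; rewrite integral_mkcond; congr (_ < _).
apply: eq_integral => x _; rewrite patchE; case: ifPn => [/set_mem Dx|/negP Dx].
  rewrite integral_mkcond; apply: eq_integral => y _; rewrite /H' !patchE.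
  have [yE|yE] := boolP (y \in E); first by rewrite mem_set//; split => //; exact/set_mem.
  by rewrite memNset ?abse0// => -[_ /mem_set]; exact/negP.
rewrite integral0_eq// => y _; rewrite /H' patchE memNset ?abse0// => -[/= /mem_set].
by [].
Qed.

Lemma measurable_section_on x : D x -> measurable_fun E (H x).
Proof.
move=> Dx; apply: (@measurable_comp _ _ _ _ _ _ (D `*` E) (fun z => H z.1 z.2) E (pair x)) => //.
- exact: measurableX.
- by move=> _ [y Ey <-]; split.
- by apply: measurable_funTS; exact: measurable_fun_pair.
Qed.

End iterated_integrals.

Section polar_integration.
Context {R : realType}.
Local Notation mu := (@lebesgue_measure R).
Local Notation P := (`]0%R, +oo[%classic : set R).
Implicit Types H : R -> R -> \bar R.
Local Open Scope ereal_scope.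

Lemma mem_posE (x : R) : P x = (0 < x)%R.
Proof. by rewrite /= in_itv/= andbT. Qed.

Let measurable_polar H : measurable_fun (P `*` P) (fun z => H z.1 z.2) ->
  measurable_fun (P `*` P) (fun z => z.1%:E * H z.1 (z.1 * z.2)%R).
Proof.
move=> mH; apply: emeasurable_funM; first exact/measurable_EFinP/measurable_funTS.
pose g (z : R * R) := (z.1, (z.1 * z.2)%R).
apply: (@measurable_comp _ _ _ _ _ _ (P `*` P) (fun z => H z.1 z.2) _ g) => //.
- exact: measurableX.
- move=> _ [[x y] [/= + +] <-] /=; rewrite !in_itv/= !andbT => x0 y0.
  by split => //; exact: mulr_gt0.
- by apply: measurable_funTS; apply: measurable_fun_pair => //; exact: measurable_funM.
Qed.

(** For fixed [r], substitute s = r t in the inner integral, with Jacobian [r]; then exchange [r]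
    and [t]. *)
Lemma tonelli_polar H : measurable_fun (P `*` P) (fun z => H z.1 z.2) ->
  (forall x y, (0 < x)%R -> (0 < y)%R -> 0 <= H x y) ->
  \int[mu]_(r in P) \int[mu]_(s in P) H r s =
  \int[mu]_(t in P) \int[mu]_(r in P) (r%:E * H r (r * t)%R).
Proof.
move=> mH H0.
transitivity (\int[mu]_(r in P) \int[mu]_(t in P) (r%:E * H r (r * t)%R)).
  apply: eq_integral => r /set_mem Pr; apply: ge0_integral_scale.
  - by rewrite -mem_posE.
  - exact: (measurable_section_on _ _ mH Pr).
  - by move=> s; rewrite mem_posE; apply: H0; rewrite -mem_posE.
apply: (@tonelli_on _ _ _ _ _ mu mu P P _ _ (fun r t => r%:E * H r (r * t)%R)) => //.
  exact: measurable_polar.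
move=> x y; rewrite !mem_posE => x0 y0.
by apply: mule_ge0; [rewrite lee_fin ltW|apply: H0; rewrite ?mulr_gt0].
Qed.

(** Absolute convergence is asked in the coordinates (t, r), where it will be verified; it justifies
    the exchange, which follows the substitution s = r t. *)
Lemma fubini_polar H : measurable_fun (P `*` P) (fun z => H z.1 z.2) ->
  \int[mu]_(t in P) \int[mu]_(r in P) (r%:E * `|H r (r * t)%R|) < +oo ->
  \int[mu]_(r in P) \int[mu]_(s in P) H r s =
  \int[mu]_(t in P) \int[mu]_(r in P) (r%:E * H r (r * t)%R).
Proof.
move=> mH Hoo.
transitivity (\int[mu]_(r in P) \int[mu]_(t in P) (r%:E * H r (r * t)%R)).
  apply: eq_integral => r /set_mem Pr; apply: integral_scale.
  - by rewrite -mem_posE.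
  - exact: (measurable_section_on _ _ mH Pr).
apply: (@fubini_on _ _ _ _ _ mu mu P P _ _ (fun r t => r%:E * H r (r * t)%R)).
- by [].
- by [].
- exact: measurable_polar.
have -> : \int[mu]_(r in P) \int[mu]_(t in P) `|r%:E * H r (r * t)%R| =
    \int[mu]_(t in P) \int[mu]_(r in P) `|r%:E * H r (r * t)%R|.
  apply: (@tonelli_on _ _ _ _ _ mu mu P P _ _ (fun r t => `|r%:E * H r (r * t)%R|)).
  - by [].
  - by [].
  - by apply: measurableT_comp; [exact: abse_measurable|exact: measurable_polar].
  - by move=> x y _ _; exact: abse_ge0.
suff -> : \int[mu]_(t in P) \int[mu]_(r in P) `|r%:E * H r (r * t)%R| =
    \int[mu]_(t in P) \int[mu]_(r in P) (r%:E * `|H r (r * t)%R|) by exact: Hoo.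
apply: eq_integral => t _; apply: eq_integral => r /set_mem.
by rewrite mem_posE => r0; rewrite abseM (@gee0_abs _ r%:E)// lee_fin ltW.
Qed.

End polar_integration.

(** * Integrability of powers at 0 and at infinity *)

Section power_integrals.
Context {R : realType}.
Local Notation mu := (@lebesgue_measure R).
Implicit Types b x y : R.
Local Open Scope ereal_scope.

Lemma powR_gt0_continuous b x : (0 < x)%R -> {for x, continuous (@powR R ^~ b)}.
Proof.
move=> x0; apply: differentiable_continuous; apply/derivable1_diffP.
by apply: derivable_powR; rewrite in_itv/= andbT.
Qed.

Lemma integral_powR b x y : (0 < x)%R -> (x < y)%R -> (b != -1)%R ->
  \int[mu]_(t in `[x, y]) (t `^ b)%:E = ((y `^ (b + 1) - x `^ (b + 1)) / (b + 1))%:E.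
Proof.
move=> x0 xy b1.
have b10 : (b + 1 != 0)%R by rewrite addr_eq0.
have xgt0 z : (x <= z -> 0 < z)%R by exact: lt_le_trans.
have cF z : (0 < z)%R -> {for z, continuous (fun t : R => t `^ (b + 1) / (b + 1))}%R.
  by move=> z0; apply: continuousM; [exact: powR_gt0_continuous|exact: cst_continuous].
rewrite (@continuous_FTC2 _ _ (fun t => t `^ (b + 1) / (b + 1))%R)//.
- by rewrite -EFinB mulrBl.
- apply/continuous_within_itvP => //; split.
  + by move=> z /[!in_itv]/= /andP[/ltW xz _]; apply: powR_gt0_continuous; exact: xgt0.
  + by apply: cvg_at_right_filter; exact: powR_gt0_continuous.
  + by apply: cvg_at_left_filter; apply: powR_gt0_continuous; rewrite xgt0 ?ltW.
- split.
  + move=> z /[!in_itv]/= /andP[/ltW xz _]; apply: derivableM => //.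
    by apply: derivable_powR; rewrite in_itv/= andbT xgt0.
  + by apply: cvg_at_right_filter; exact: cF.
  + by apply: cvg_at_left_filter; apply: cF; rewrite xgt0 ?ltW.
- move=> z /[!in_itv]/= /andP[/ltW xz _].
  have zi : z \in `]0%R, +oo[ by rewrite in_itv/= andbT xgt0.
  rewrite derive1E deriveMr; last exact: derivable_powR.
  rewrite -derive1E powR_derive1// addrK mulrC -mulrA mulrCA.
  by rewrite divff// mulr1.
Qed.

Lemma integral_powR01_lty b : (-1 < b)%R ->
  \int[mu]_(t in `]0%R, 1%R]) (t `^ b)%:E < +oo.
Proof.
move=> b1; have b10 : (0 < b + 1)%R by rewrite -ltrBlDr sub0r.
have mf (D : set R) : measurable_fun D (fun t : R => (t `^ b)%:E).
  by apply/measurable_EFinP; apply: measurable_funTS; exact: measurable_powR.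
(* Starting at [n.+2] keeps the endpoints distinct, as [integral_powR] demands. Each piece
   integrates to at most 1 / (b + 1). *)
have -> : `]0%R, 1%R]%classic = \bigcup_n `[n.+2%:R^-1%R, 1%R]%classic :> set R.
  apply/seteqP; split=> x /=; rewrite in_itv/=.
    move=> /andP[x0 x1]; exists (Num.truncn x^-1) => //=.
    rewrite in_itv/= x1 andbT invf_ple ?posrE//.
    by rewrite ltW// (lt_le_trans (Num.Theory.truncnS_gt _))// ler_nat.
  by move=> [n _ /=]; rewrite in_itv/= => /andP[+ ->]; rewrite andbT; apply: lt_le_trans.
apply: (@le_lt_trans _ _ ((b + 1)^-1)%:E); last exact: ltry.
have cv : \int[mu]_(t in `[n.+2%:R^-1%R, 1%R]%classic) (t `^ b)%:E @[n --> \oo] -->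
    \int[mu]_(t in \bigcup_n `[n.+2%:R^-1%R, 1%R]%classic) (t `^ b)%:E.
  apply: ge0_nondecreasing_set_cvg_integral => //.
  - move=> n m nm; apply/subsetPset => x /=; rewrite !in_itv/= => /andP[+ ->].
    by rewrite andbT; apply: le_trans; rewrite lef_pV2 ?posrE// ler_nat !ltnS.
  - by move=> n; exact: mf.
  - by move=> n x _; rewrite lee_fin powR_ge0.
rewrite -(cvg_lim _ cv)//; apply: lime_le; first by apply/cvg_ex; eexists; exact: cv.
apply: nearW => n; rewrite integral_powR ?gt_eqF//; last first.
  by rewrite invf_lt1// ltr1n.
by rewrite lee_fin powR1 -[leRHS]mul1r ler_pM2r ?invr_gt0// lerBlDr lerDl powR_ge0.
Qed.

Lemma integral_powR1y_lty b : (b < -1)%R ->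
  \int[mu]_(t in `[1%R, +oo[) (t `^ b)%:E < +oo.
Proof.
move=> b1; have b10 : (b + 1 < 0)%R by rewrite -ltrBrDr sub0r.
have mf (D : set R) : measurable_fun D (fun t : R => (t `^ b)%:E).
  by apply/measurable_EFinP; apply: measurable_funTS; exact: measurable_powR.
have -> : `[1%R, +oo[%classic = \bigcup_n `[1%R, n.+2%:R]%classic :> set R.
  apply/seteqP; split=> x /=; rewrite in_itv/=.
    rewrite andbT => x1; exists (Num.truncn x) => //=.
    by rewrite in_itv/= x1/= ltW// (lt_le_trans (Num.Theory.truncnS_gt _))// ler_nat.
  by move=> [n _ /=]; rewrite in_itv/= => /andP[->].
(* As b + 1 < 0, the integral over [1, y] is (1 - y^(b + 1)) / -(b + 1), hence at most 1 / -(b +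
   1). *)
apply: (@le_lt_trans _ _ ((- (b + 1))^-1)%:E); last exact: ltry.
have cv : \int[mu]_(t in `[1%R, n.+2%:R]%classic) (t `^ b)%:E @[n --> \oo] -->
    \int[mu]_(t in \bigcup_n `[1%R, n.+2%:R]%classic) (t `^ b)%:E.
  apply: ge0_nondecreasing_set_cvg_integral => //.
  - move=> n m nm; apply/subsetPset => x /=; rewrite !in_itv/= => /andP[-> /=].
    by move=> xn; rewrite (le_trans xn)// ler_nat !ltnS.
  - by move=> n; exact: mf.
  - by move=> n x _; rewrite lee_fin powR_ge0.
rewrite -(cvg_lim _ cv)//; apply: lime_le; first by apply/cvg_ex; eexists; exact: cv.
apply: nearW => n; rewrite integral_powR ?lt_eqF// ?ltr1n//.
rewrite lee_fin powR1 -[(b + 1)^-1%R]opprK -invrN mulrN -mulNr opprB.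
by rewrite -[leRHS]mul1r ler_pM2r ?invr_gt0 ?oppr_gt0// lerBlDr lerDl powR_ge0.
Qed.

End power_integrals.

(** * Homogeneous kernels in the coordinates (r, s / r) *)

Section ray_integrals.
Context {R : realType}.
Local Notation mu := (@lebesgue_measure R).
Local Notation P := (`]0%R, +oo[%classic : set R).
Implicit Types (x y r s t : R).

Lemma powRD_gt0 x r s : 0 < x -> x `^ (r + s) = x `^ r * x `^ s.
Proof. by move=> x0; rewrite powRD// (gt_eqF x0) implybT. Qed.

Lemma measurable_inv_pos : measurable_fun P (fun r : R => r^-1).
Proof.
apply: (eq_measurable_fun (fun r => r `^ (-1))).
  by move=> r /set_mem; rewrite mem_posE => r0; rewrite powR_inv1// ltW.
by apply: measurable_funTS; exact: measurable_powR.
Qed.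

Lemma ge0_integral_le_indic (h : R -> R) (m M k : R) : 0 < m -> m <= M ->
  measurable_fun P h -> (forall r, 0 < r -> 0 <= h r) ->
  (forall r, 0 < r -> ~~ (m <= r <= M) -> h r = 0) ->
  (forall r, m <= r <= M -> h r <= k) ->
  (\int[mu]_(r in P) (h r)%:E <= (k * (M - m))%:E)%E.
Proof.
move=> m0 mM mh h0 hout hk.
have k0 : 0 <= k by rewrite (le_trans (h0 m m0))// hk// lexx.
apply: (@le_trans _ _ (\int[mu]_(r in P) (k%:E * (\1_`[m, M] r)%:E))%E).
  apply: ge0_le_integral => //.
  - by move=> r; rewrite mem_posE lee_fin; exact: h0.
  - exact/measurable_EFinP.
  - by apply: measurable_funeM; apply/measurable_EFinP; exact: measurable_indic.
  - move=> r; rewrite mem_posE => r0; rewrite -EFinM lee_fin indicE.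
    have [rmM|rmM] := boolP (m <= r <= M).
      by rewrite mem_set ?mulr1 ?hk//= in_itv.
    by rewrite hout// mulr_ge0.
rewrite ge0_integralZl//; last first.
  by apply/measurable_EFinP; exact: measurable_indic.
rewrite integral_indic// setIidl.
  have mE : mu `[m, M]%classic = (M - m)%:E.
    rewrite lebesgue_measure_itv/= lte_fin; case: ltP => [_|Mm]; first by rewrite EFinB.
    by rewrite (_ : M = m) ?subrr//; apply/eqP; rewrite eq_le mM Mm.
  by rewrite EFinM -mE.
by move=> r; rewrite mem_posE/= in_itv/= => /andP[mr _]; exact: lt_le_trans mr.
Qed.

Lemma measurable_ln1D : measurable_fun setT (fun t : R => (ln (1 + t))%:E).
Proof.
apply/measurable_EFinP; apply: measurableT_comp => //.
exact: measurable_funD.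
Qed.

Section kernel.
Variables (kappa : R -> R) (gamma p c2 : R).
Local Notation a := ((gamma + 3) / 2).
Hypothesis kappa_meas : measurable_fun P kappa.
Hypothesis kappa_ge0 : forall t, 0 < t -> 0 <= kappa t.
Hypothesis kappa_le : forall t, 0 < t ->
  kappa t <= c2 * ((1 + t) `^ (gamma + 2 * p) * t `^ (- p)).
Hypothesis gamma_p : gamma + 2 * p < 1.
Hypothesis c2_ge0 : 0 <= c2.

Let kta_meas (D : set R) : measurable D -> D `<=` P ->
  measurable_fun D (fun t => kappa t * t `^ (- a)).
Proof.
move=> mD DP; apply: measurable_funM; first exact: measurable_funS kappa_meas.
by apply: measurable_funTS; exact: measurable_powR.
Qed.

(** This exponent equals -1 + (1 - gamma - 2p) / 2. It governs the behaviour at 0, where [kappa t]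
    is O(t^-p) and the remaining factor is O(t). *)
Let exp1 : -1 < - p - a + 1.
Proof. by move: gamma_p => gp; lra. Qed.

Let exp2 : 0 < (1 - gamma - 2 * p) / 2.
Proof. by move: gamma_p => gp; lra. Qed.

(** Without [e] the exponent is -1 - (1 - gamma - 2p) / 2: the margin is exactly what a factor t^e
    may use up at infinity. *)
Let exp3 e : e < (1 - gamma - 2 * p) / 2 -> gamma + 2 * p - p - a + e < -1.
Proof. by move: gamma_p => gp; lra. Qed.

Lemma measurable_homogeneous_kernel :
  measurable_fun (P `*` P) (fun z => z.1 `^ gamma * kappa (z.2 / z.1)).
Proof.
have mP : measurable (P `*` P) by exact: measurableX.
have mp b : measurable_fun setT (fun z : R * R => z.1 `^ b).
  exact: (measurableT_comp (measurable_powR _)).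
apply: measurable_funM; first exact: measurable_funTS.
pose d (z : R * R) := z.2 * z.1 `^ (-1).
apply: (eq_measurable_fun (kappa \o d)).
  move=> z /set_mem[]; rewrite !mem_posE => z1 z2.
  by rewrite /d /= powR_inv1// ltW.
apply: (@measurable_comp _ _ _ _ _ _ P kappa _ d) => //.
- move=> _ [z [] + + <-]; rewrite !mem_posE => z1 z2.
  by rewrite /d mulr_gt0// powR_gt0.
- by apply: measurable_funTS; exact: measurable_funM.
Qed.

Let density_meas : measurable_fun setT (fun z : R * R => z.2 `^ (- a) * z.1 `^ (- a)).
Proof. by apply: measurable_funM; exact: (measurableT_comp (measurable_powR _)). Qed.

(** A nonnegative exponent is below 1, so the power is at most 2; a negative one gives at most 1,
    the base being at least 1. *)
Let powR1D_le1 t : 0 < t -> t <= 1 -> (1 + t) `^ (gamma + 2 * p) <= 2.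
Proof.
move=> t0 t1; have [q0|q0] := leP 0 (gamma + 2 * p).
  apply: (@le_trans _ _ ((2 : R) `^ (gamma + 2 * p))).
    by apply: ge0_ler_powR => //; rewrite ?nnegrE; lra.
  by rewrite -[leRHS]powRr1// ler_powR ?ler1n// ltW.
rewrite (@le_trans _ _ 1) ?ler1n// -[leRHS](@powRr0 _ (1 + t)).
by rewrite ler_powR ?(ltW q0)// lerDl ltW.
Qed.

(** Write 1 + t = t (1 + 1/t) and apply the previous bound at 1/t. *)
Let powR1D_ge1 t : 1 <= t ->
  (1 + t) `^ (gamma + 2 * p) <= 2 * t `^ (gamma + 2 * p).
Proof.
move=> t1; have t0 : 0 < t by exact: lt_le_trans t1.
rewrite (_ : 1 + t = t * (1 + t^-1)); last by field; rewrite gt_eqF.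
rewrite powRM ?addr_ge0 ?invr_ge0 ?(ltW t0)// mulrC ler_wpM2r ?powR_ge0//.
by apply: powR1D_le1; rewrite ?invr_gt0 ?invf_le1.
Qed.

(** Common source of both finiteness results: [J] will be the absolute integral of the test-function
    increment, with [e = 0], and then ln (1 + t), with a small [e > 0]. *)
Lemma kernel_moment_lty (J : R -> \bar R) (C e : R) : 0 <= C ->
  e < (1 - gamma - 2 * p) / 2 -> measurable_fun P J ->
  (forall t, 0 < t -> (0 <= J t)%E) ->
  (forall t, 0 < t -> t <= 1 -> (J t <= (C * t)%:E)%E) ->
  (forall t, 1 <= t -> (J t <= (C * t `^ e)%:E)%E) ->
  (\int[mu]_(t in P) ((kappa t * t `^ (- a))%:E * J t) < +oo)%E.
Proof.
move=> C0 ep mJ J0 Jle1 Jge1.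
have mkJ (D : set R) : measurable D -> D `<=` P ->
    measurable_fun D (fun t => ((kappa t * t `^ (- a))%:E * J t)%E).
  move=> mD DP; apply: emeasurable_funM; first by apply/measurable_EFinP; exact: kta_meas.
  exact: measurable_funS mJ.
have k0 t : 0 < t -> 0 <= kappa t * t `^ (- a) by move=> t0; rewrite mulr_ge0 ?powR_ge0 ?kappa_ge0.
have PE : P = `]0%R, 1%R]%classic `|` `]1%R, +oo[%classic.
  by rewrite -itv_bndbnd_setU// bnd_simp.
rewrite {1}PE ge0_integral_setU//; last 3 first.
- by rewrite -PE; exact: mkJ.
- by move=> t; rewrite -PE mem_posE => t0; rewrite mule_ge0 ?lee_fin ?k0 ?J0.
- by apply/disj_setPLR => t /=; rewrite !in_itv/= => /andP[_ t1]; rewrite andbT ltNge t1.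
(* The dominating power: [c2] comes from the kernel bound, 2 from the bounds on (1 + t)^(gamma +
   2p), and [C] from [J]. *)
pose w b t : \bar R := ((c2 * 2 * C)%:E * (t `^ b)%:E)%E.
have mw (D : set R) b : measurable D -> measurable_fun D (w b).
  move=> mD; apply: measurable_funeM; apply/measurable_EFinP.
  by apply: measurable_funTS; exact: measurable_powR.
have mpow (D : set R) b : measurable_fun D (fun t : R => (t `^ b)%:E).
  by apply/measurable_EFinP; apply: measurable_funTS; exact: measurable_powR.
apply: lte_add_pinfty.
- apply: (@le_lt_trans _ _ (\int[mu]_(t in `]0%R, 1%R]) w (- p - a + 1)%R t)%E).
    apply: ge0_le_integral => //.
    + move=> t /=; rewrite in_itv/= => /andP[t0 _].
      by rewrite mule_ge0 ?lee_fin ?k0 ?J0.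
    + by apply: mkJ => // t /=; rewrite !in_itv/= => /andP[-> _].
    + exact: mw.
    + move=> t /=; rewrite in_itv/= => /andP[t0 t1].
      apply: (@le_trans _ _ ((kappa t * t `^ (- a))%:E * (C * t)%:E)%E).
        by rewrite lee_wpmul2l ?lee_fin ?k0 ?Jle1.
      have t0' := ltW t0.
      rewrite /w -!EFinM lee_fin !powRD_gt0// (powRr1 t0').
      rewrite [X in _ <= X](_ : _ = (c2 * (2 * t `^ (- p))) * t `^ (- a) * (C * t)); last by ring.
      rewrite ler_wpM2r ?mulr_ge0// ler_wpM2r ?powR_ge0//.
      rewrite (le_trans (kappa_le t0))// ler_wpM2l// ler_wpM2r ?powR_ge0//.
      exact: powR1D_le1.
  rewrite ge0_integralZl//; last 3 first.
  + exact: mpow.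
  + by move=> t _; rewrite lee_fin powR_ge0.
  + by rewrite lee_fin !mulr_ge0.
  apply: lte_mul_pinfty => //; first by rewrite lee_fin !mulr_ge0.
  by apply: integral_powR01_lty; exact: exp1.
- apply: (@le_lt_trans _ _ (\int[mu]_(t in `]1%R, +oo[) w (gamma + 2 * p - p - a + e)%R t)%E).
    have t0 t : `]1%R, +oo[%classic t -> 0 < t.
      by rewrite /= in_itv/= andbT; exact: lt_trans.
    apply: ge0_le_integral => //.
    + by move=> t /t0 tt; rewrite mule_ge0 ?lee_fin ?k0 ?J0.
    + by apply: mkJ => // t /t0; rewrite mem_posE.
    + exact: mw.
    + move=> t /[dup] /t0 {}t0 /=; rewrite in_itv/= andbT => t1.
      apply: (@le_trans _ _ ((kappa t * t `^ (- a))%:E * (C * t `^ e)%:E)%E).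
        by rewrite lee_wpmul2l ?lee_fin ?k0 ?Jge1 ?(ltW t1).
      rewrite /w -!EFinM lee_fin (powRD_gt0 _ e)// (powRD_gt0 _ (- a))// (powRD_gt0 _ (- p))//.
      rewrite [X in _ <= X](_ : _ = (c2 * ((2 * t `^ (gamma + 2 * p)) * t `^ (- p))) * t `^ (- a) * (C * t `^ e)); last by ring.
      rewrite ler_wpM2r ?mulr_ge0 ?powR_ge0// ler_wpM2r ?powR_ge0//.
      rewrite (le_trans (kappa_le t0))// ler_wpM2l// ler_wpM2r ?powR_ge0//.
      by apply: powR1D_ge1; exact: ltW.
  rewrite ge0_integralZl//; last 3 first.
  + exact: mpow.
  + by move=> t _; rewrite lee_fin powR_ge0.
  + by rewrite lee_fin !mulr_ge0.
  apply: lte_mul_pinfty => //; first by rewrite lee_fin !mulr_ge0.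
  apply: (@le_lt_trans _ _ (\int[mu]_(t in `[1%R, +oo[) (t `^ (gamma + 2 * p - p - a + e)%R)%:E)%E).
    apply: ge0_subset_integral => //.
    - exact: mpow.
    - by move=> t _; rewrite lee_fin powR_ge0.
    - by move=> t /=; rewrite !in_itv/= !andbT => /ltW.
  by apply: integral_powR1y_lty; exact: exp3.
Qed.

(** * The weak formulation along the ray *)

Section stationarity.
Variables (g : R -> R) (L m M : R).
Hypothesis g_meas : measurable_fun setT g.
Hypothesis L_ge0 : 0 <= L.
Hypotheses (m_gt0 : 0 < m) (mM : m <= M).
Hypothesis g_out : forall r, 0 < r -> ~~ (m <= r <= M) -> g r = 0.
Hypothesis g_lip : forall r s, 0 < r -> 0 < s -> `|g r - g s| <= L * `|r - s|.

Let q r := r `^ (-2).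
Let q_ge0 r : 0 <= q r. Proof. exact: powR_ge0. Qed.
Let q_meas (D : set R) : measurable_fun D q.
Proof. by apply: measurable_funTS; exact: measurable_powR. Qed.
Let M_gt0 : 0 < M. Proof. exact: lt_le_trans mM. Qed.

Let qM c r : 0 < c -> 0 < r -> q r = c `^ 2 * q (c * r).
Proof.
move=> c0 r0; rewrite /q powRM ?ltW// mulrA -powRD_gt0// subrr powRr0 mul1r.
by [].
Qed.

Let q_le r s : 0 < r -> r <= s -> q s <= q r.
Proof.
move=> r0 rs; have s0 := lt_le_trans r0 rs.
by rewrite /q !powRN lef_pV2 ?posrE ?powR_gt0// ge0_ler_powR// nnegrE ltW.
Qed.

(** [M + 1] lies outside the support, so the Lipschitz bound measured from there controls [g] on
    [m, M]. *)
Let g_bound r : 0 < r -> `|g r| <= L * (M + 1).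
Proof.
move=> r0; have [/andP[mr rM]|/(g_out r0) ->] := boolP (m <= r <= M); last first.
  by rewrite normr0 mulr_ge0// addr_ge0// ltW.
have M10 : 0 < M + 1 by rewrite addr_gt0.
have gM : g (M + 1) = 0.
  by apply: g_out => //; rewrite negb_and -!ltNge ltrDl ltr01 orbT.
rewrite -[X in `|X|]subr0 -gM (le_trans (g_lip r0 M10))// ler_wpM2l//.
by rewrite ler_norml; apply/andP; split; lra.
Qed.

Let qw_meas (w : R -> R) : measurable_fun P w -> measurable_fun P (fun r => (q r * w r)%:E).
Proof. by move=> mw; apply/measurable_EFinP; apply: measurable_funM => //; exact: q_meas. Qed.

Let gc_meas c : measurable_fun P (fun r => g (c * r)).
Proof. by apply: measurable_funTS; apply: measurableT_comp => //; exact: measurable_funM. Qed.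

Let A0 := (\int[mu]_(r in P) (q r * `|g r|)%:E)%E.

Let A0_lty : (A0 < +oo)%E.
Proof.
apply: (@le_lt_trans _ _ (q m * (L * (M + 1)) * (M - m))%:E); last exact: ltry.
apply: ge0_integral_le_indic => //.
- by apply: measurable_funM => //; apply: measurableT_comp => //; exact: measurable_funTS.
- by move=> r r0; rewrite mulr_ge0.
- by move=> r r0 /(g_out r0) ->; rewrite normr0 mulr0.
- move=> r /andP[mr rM]; have r0 := lt_le_trans m_gt0 mr.
  by rewrite ler_pM// ?g_bound// q_le.
Qed.

(* [r^-2 dr] is the density for which dilation by [c] multiplies integrals by [c] *)
Let scale_q c (h : R -> R) : 0 < c -> measurable_fun P h ->
  (\int[mu]_(r in P) (q r * h (c * r))%:E = \int[mu]_(r in P) (c * (q r * h r))%:E)%E.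
Proof.
move=> c0 mh; rewrite [RHS](integral_scale c0).
  apply: eq_integral => r /set_mem; rewrite mem_posE => r0.
  rewrite -EFinM; congr EFin; rewrite (qM c0 r0) powR_mulrn ?ltW//; ring.
by apply/measurable_EFinP; do 2 apply: measurable_funM => //.
Qed.

Let D t := (\int[mu]_(r in P) (q r * `|g ((1 + t) * r) - g r|)%:E)%E.

(** For t <= 1 the integrand lives on [m/2, M], since (1 + t) r <= 2 r < m below m/2. There the
    Lipschitz bound L t r reduces r^-2 to r^-1 <= 2 / m. *)
Let D_le t : 0 < t -> t <= 1 ->
  (D t <= ((L * (2 / m) * M) * t)%:E)%E.
Proof.
move=> t0 t1; have [t0' m0'] := (ltW t0, ltW m_gt0).
apply: (@le_trans _ _ (L * t * (2 / m) * (M - m / 2))%:E); last first.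
  rewrite lee_fin (_ : L * (2 / m) * M * t = L * t * (2 / m) * M); last by ring.
  by rewrite ler_wpM2l ?mulr_ge0 ?invr_ge0// gerBl divr_ge0.
have m2 : 0 < m / 2 by rewrite divr_gt0.
apply: ge0_integral_le_indic => //.
- by rewrite (le_trans _ mM)// ler_pdivrMr// ler_pMr// ler1n.
- apply: measurable_funM => //; apply: measurableT_comp => //.
  by apply: measurable_funB => //; exact: measurable_funTS.
- by move=> r r0; rewrite mulr_ge0.
- move=> r r0; rewrite negb_and -!ltNge => /orP[rm|Mr].
  + rewrite !g_out ?subrr ?normr0 ?mulr0 ?mulr_gt0 ?addr_gt0// negb_and -!ltNge.
      by apply/orP; left; lra.
    apply/orP; left; apply: (@le_lt_trans _ _ (2 * r)); first by rewrite ler_pM2r//; lra.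
    lra.
  + rewrite !g_out ?subrr ?normr0 ?mulr0 ?mulr_gt0 ?addr_gt0// negb_and -!ltNge ?Mr ?orbT//.
    by apply/orP; right; have := mulr_gt0 t0 r0; rewrite mulrDl mul1r; lra.
- move=> r /andP[mr rM]; have r0 : 0 < r by exact: lt_le_trans mr.
  apply: (@le_trans _ _ (q r * (L * (t * r)))).
    rewrite ler_wpM2l// (le_trans (g_lip _ _))// ?mulr_gt0 ?addr_gt0//.
    by rewrite mulrDl mul1r addrAC subrr add0r ger0_norm// mulr_ge0 ?ltW.
  rewrite (_ : q r * _ = L * t * r^-1); last first.
    rewrite /q (_ : -2 = -1 + -1) ?powRD_gt0 ?powR_inv1 ?ltW//; last by lra.
    by field; rewrite gt_eqF.
  by rewrite ler_wpM2l ?mulr_ge0// -(invf_div m 2) lef_pV2 ?posrE.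
Qed.

(** As (1 + t) r = (1 + 1/t) (t r), dilation by [t] gives t times [D] at 1/t, and the latter is
    O(1/t) by [D_le]. *)
Let D'_le t : 1 <= t ->
  (\int[mu]_(r in P) (q r * `|g ((1 + t) * r) - g (t * r)|)%:E <=
    (L * (2 / m) * M)%:E)%E.
Proof.
move=> t1; have t0 : 0 < t by exact: lt_le_trans t1.
pose h r := `|g ((1 + t^-1) * r) - g r|.
have mh : measurable_fun P h.
  apply: measurableT_comp => //.
  by apply: measurable_funB => //; exact: measurable_funTS.
rewrite (_ : integral _ _ _ = \int[mu]_(r in P) (q r * h (t * r))%:E)%E; last first.
  apply: eq_integral => r _; rewrite /h (_ : (1 + t^-1) * (t * r) = (1 + t) * r)//.
  by field; rewrite gt_eqF.
rewrite scale_q//.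
under eq_integral do rewrite EFinM.
rewrite ge0_integralZl_EFin ?(ltW t0)//; last 2 first.
- by move=> r _; rewrite lee_fin mulr_ge0 ?normr_ge0.
- exact: qw_meas.
apply: (@le_trans _ _ (t%:E * (L * (2 / m) * M * t^-1)%:E)%E).
  rewrite lee_wpmul2l ?lee_fin ?(ltW t0)//; apply: D_le; first by rewrite invr_gt0.
  by rewrite invf_le1.
by rewrite -EFinM lee_fin mulrC divfK// gt_eqF.
Qed.

Let abs_scale c : 0 < c ->
  (\int[mu]_(r in P) (q r * `|g (c * r)|)%:E = c%:E * A0)%E.
Proof.
move=> c0; have mg : measurable_fun P (fun r => `|g r|).
  by apply: measurableT_comp => //; exact: measurable_funTS.
rewrite (scale_q (h := fun r => `|g r|))//.
under eq_integral do rewrite EFinM.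
rewrite ge0_integralZl_EFin ?(ltW c0)//.
- by move=> r _; rewrite lee_fin mulr_ge0 ?normr_ge0.
- exact: qw_meas.
Qed.

Let N t r := q r * (g ((1 + t) * r) - g r - g (t * r)).

Let N_meas t : measurable_fun P (N t).
Proof.
apply: measurable_funM => //; apply: measurable_funB => //.
by apply: measurable_funB => //; exact: measurable_funTS.
Qed.

Let J t := (\int[mu]_(r in P) `|N t r|%:E)%E.

Let a0 := fine A0.
Let A0E : A0 = a0%:E.
Proof.
rewrite fineK// ge0_fin_numE//.
by apply: integral_ge0 => r _; rewrite lee_fin mulr_ge0 ?normr_ge0.
Qed.

Let a0_ge0 : 0 <= a0.
Proof.
rewrite -lee_fin -A0E; apply: integral_ge0 => r _.
by rewrite lee_fin mulr_ge0 ?normr_ge0.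
Qed.

Let C := L * (2 / m) * M + a0.
Let C_ge0 : 0 <= C.
Proof. by rewrite addr_ge0// !mulr_ge0 ?invr_ge0// ltW. Qed.

(** The increment has three terms, two of which nearly cancel. [u] is the cancelling pair and [v]
    the term left over; which pair to choose depends on whether t <= 1. *)
Let J_le_sum t (u v : R -> R) : measurable_fun P u -> measurable_fun P v ->
  (forall r, 0 < r -> g ((1 + t) * r) - g r - g (t * r) = u r - v r) ->
  (J t <= \int[mu]_(r in P) (q r * `|u r|)%:E + \int[mu]_(r in P) (q r * `|v r|)%:E)%E.
Proof.
move=> mu_ mv uv.
have mq (w : R -> R) : measurable_fun P w -> measurable_fun P (fun r => (q r * `|w r|)%:E).
  by move=> mw; apply/measurable_EFinP; apply: measurable_funM => //; exact: measurableT_comp.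
have q0 (w : R -> R) r : P r -> (0 <= (q r * `|w r|)%:E)%E.
  by move=> _; rewrite lee_fin mulr_ge0 ?normr_ge0.
rewrite -ge0_integralD//; [|exact: q0|exact: mq|exact: q0|exact: mq].
apply: ge0_le_integral => //.
- by apply/measurable_EFinP; apply: measurableT_comp => //; exact: N_meas.
- by apply: emeasurable_funD; exact: mq.
- move=> r; rewrite mem_posE => r0; rewrite -EFinD lee_fin /N uv//.
  by rewrite normrM (ger0_norm (q_ge0 r)) -mulrDr ler_wpM2l// ler_normB.
Qed.

(** For small [t] the pair is g((1 + t) r) and g(r); the term g(t r) left over contributes t A0,
    also O(t). *)
Let J_le1 t : 0 < t -> t <= 1 -> (J t <= (C * t)%:E)%E.
Proof.
move=> t0 t1; rewrite /C mulrDl EFinD.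
apply: (@le_trans _ _ (D t + t%:E * A0)%E); last first.
  by rewrite A0E -EFinM [t * _]mulrC leeD2r// D_le.
rewrite -abs_scale//; apply: J_le_sum => //.
by apply: measurable_funB => //; exact: measurable_funTS.
Qed.

(** For large [t] the pair is g((1 + t) r) and g(t r); the term g(r) left over contributes the
    constant A0. *)
Let J_ge1 t : 1 <= t -> (J t <= C%:E)%E.
Proof.
move=> t1; rewrite /C EFinD -A0E.
apply: (@le_trans _ _ (\int[mu]_(r in P) (q r * `|g ((1 + t) * r) - g (t * r)|)%:E + A0)%E); last first.
  by rewrite leeD2r// D'_le.
apply: J_le_sum => //.
- exact: measurable_funB.
- exact: measurable_funTS.
- by move=> r _; rewrite addrAC.
Qed.

Let N_integrable c : 0 < c -> mu.-integrable P (EFin \o (fun r => q r * g (c * r))).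
Proof.
move=> c0; apply/integrableP; split.
  exact: qw_meas.
rewrite (_ : integral _ _ _ = \int[mu]_(r in P) (q r * `|g (c * r)|)%:E)%E.
  by rewrite abs_scale// A0E -EFinM ltry.
apply: eq_integral => r _ /=; by rewrite normrM (ger0_norm (q_ge0 r)).
Qed.

Let N_integral t : 0 < t -> (\int[mu]_(r in P) (N t r)%:E = 0)%E.
Proof.
move=> t0; have t10 : 0 < 1 + t by rewrite addr_gt0.
have scaleE c : 0 < c ->
    (\int[mu]_(r in P) (q r * g (c * r))%:E = c%:E * \int[mu]_(r in P) (q r * g r)%:E)%E.
  move=> c0; rewrite scale_q//; last exact: measurable_funTS.
  under eq_integral do rewrite EFinM.
  rewrite integralZl//; have := N_integrable ltr01; apply: eq_integrable => // r _ /=.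
  by rewrite mul1r.
have Ng : mu.-integrable P (EFin \o (fun r => q r * g r)).
  by have := N_integrable ltr01; apply: eq_integrable => // r _ /=; rewrite mul1r.
under eq_integral do rewrite /N !mulrBr EFinB EFinB.
rewrite integralB//; last 2 first.
- by apply: integrableB => //; exact: N_integrable.
- exact: N_integrable.
rewrite integralB//; last exact: N_integrable.
rewrite !scaleE//.
(* The common integral of [q g] is finite, so the coefficients (1 + t) - 1 - t may be collected as
   real numbers. *)
have := integrable_fin_num _ Ng; move=> /(_ _)/fineK <-//.
by rewrite -!EFinM -!EFinB; congr EFin; ring.
Qed.

Let G r s := r `^ gamma * kappa (s / r) * (g (r + s) - g r - g s) * (s `^ (- a) * r `^ (- a)).

(** The choice of [a] acts here: the powers of [r] add up to 1 + gamma - 2a = -2, including the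
    Jacobian. *)
Let G_polar r t : 0 < r -> 0 < t ->
  r * G r (r * t) = kappa t * t `^ (- a) * N t r.
Proof.
move=> r0 t0; have rq : r * r `^ gamma * r `^ (- a) * r `^ (- a) = q r.
  by rewrite -{1}(powRr1 (ltW r0)) -!powRD_gt0// /q; congr (_ `^ _); field.
rewrite /G /N -rq powRM ?ltW// (_ : r * t / r = t); last by field; rewrite gt_eqF.
rewrite (_ : (1 + t) * r = r + r * t); last by ring.
by rewrite (mulrC t r); ring.
Qed.

Let G_meas : measurable_fun (P `*` P) (fun z => G z.1 z.2).
Proof.
have mP : measurable (P `*` P) by exact: measurableX.
apply: measurable_funM; last exact: measurable_funTS.
apply: measurable_funM; first exact: measurable_homogeneous_kernel.
apply: measurable_funTS; apply: measurable_funB; last exact: measurableT_comp.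
apply: measurable_funB; last exact: measurableT_comp.
by apply: measurableT_comp => //; exact: measurable_funD.
Qed.

Let G_abs_lty : (\int[mu]_(r in P) \int[mu]_(s in P) `|G r s|%:E < +oo)%E.
Proof.
rewrite (@tonelli_polar _ (fun r s => `|G r s|%:E)); last 2 first.
- by apply/measurable_EFinP; apply: measurableT_comp.
- by move=> x y _ _; rewrite lee_fin.
rewrite (_ : integral _ _ _ = \int[mu]_(t in P) ((kappa t * t `^ (- a))%:E * J t))%E.
  (* [J] stays bounded at infinity, so [e = 0] suffices; it lies below the margin by [exp2]. *)
  apply: (@kernel_moment_lty _ C 0) => //.
  - apply: (@measurable_tonelli_on _ _ _ _ _ mu P P _ _ (fun t r => `|N t r|%:E)) => //.
    apply/measurable_EFinP; apply: measurable_funTS; apply: measurableT_comp => //.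
    apply: measurable_funM; first exact: (measurableT_comp (measurable_powR _)).
    apply: measurable_funB; last first.
      by apply: measurableT_comp => //; exact: measurable_funM.
    apply: measurable_funB; last exact: measurableT_comp.
    apply: measurableT_comp => //; apply: measurable_funM => //; exact: measurable_funD.
  - by move=> t t0; apply: integral_ge0.
  - by move=> t t1; rewrite powRr0 mulr1; exact: J_ge1.
apply: eq_integral => t /set_mem; rewrite mem_posE => t0.
rewrite -ge0_integralZl_EFin//.
- apply: eq_integral => r /set_mem; rewrite mem_posE => r0.
  rewrite -!EFinM -{1}(ger0_norm (ltW r0)) -normrM G_polar// normrM ger0_norm//.
  by rewrite mulr_ge0 ?powR_ge0 ?kappa_ge0.
- by apply/measurable_EFinP; apply: measurableT_comp => //; exact: N_meas.
- by rewrite mulr_ge0 ?powR_ge0 ?kappa_ge0.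
Qed.

Lemma stationary_ray :
  (\int[mu]_(r in P) \int[mu]_(s in P) `|G r s|%:E < +oo)%E /\
  (\int[mu]_(r in P) \int[mu]_(s in P) (G r s)%:E = 0)%E.
Proof.
split; first exact: G_abs_lty.
rewrite (@fubini_polar _ (fun r s => (G r s)%:E)); last 2 first.
- exact/measurable_EFinP.
- rewrite -(@tonelli_polar _ (fun r s => `|(G r s)%:E|%E)).
  + exact: G_abs_lty.
  + by apply/measurable_EFinP; apply: measurableT_comp.
  + by move=> x y _ _; exact: abse_ge0.
apply: integral0_eq => t; rewrite mem_posE => t0.
rewrite (_ : integral _ _ _ = \int[mu]_(r in P) ((kappa t * t `^ (- a))%:E * (N t r)%:E))%E.
  rewrite integralZl// ?N_integral ?mule0//.
  have -> : (fun r => (N t r)%:E) = (fun r => (EFin \o (fun r => q r * g ((1 + t) * r))%R) r -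
      (EFin \o (fun r => q r * g (1 * r))%R) r - (EFin \o (fun r => q r * g (t * r))%R) r)%E.
    by apply/funext => r /=; rewrite /N mul1r !mulrBr.
  by apply: integrableB => //; [apply: integrableB => //|]; apply: N_integrable; rewrite ?addr_gt0.
apply: eq_integral => r /set_mem; rewrite mem_posE => r0.
by rewrite -!EFinM G_polar.
Qed.

End stationarity.

(** * The flux constant and the flux along the ray *)

Lemma ln_le_powR x e : 0 < x -> 0 < e -> ln x <= x `^ e / e.
Proof.
move=> x0 e0; rewrite ler_pdivlMr// mulrC -ln_powR.
have xe0 : 0 < x `^ e by exact: powR_gt0.
(* ln (1 + u) <= u at u = x^e - 1 bounds ln (x^e) = e ln x. *)
by have := le_ln1Dx (x := x `^ e - 1); rewrite subrKC ltrBrDr addrC subrr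
  => /(_ xe0) /le_trans; apply; rewrite gerBl.
Qed.

Definition flux_constant : \bar R :=
  (\int[mu]_(t in P) ((kappa t * t `^ (- a))%:E * (ln (1 + t))%:E))%E.

Lemma flux_constant_lty : (flux_constant < +oo)%E.
Proof.
(* Half the margin: positive, so that t^e dominates the logarithm, and strictly below what
   [kernel_moment_lty] allows. *)
pose e : R := (1 - gamma - 2 * p) / 4.
have e0 : 0 < e by move: gamma_p => gp; rewrite /e; lra.
have ee : e < (1 - gamma - 2 * p) / 2 by move: gamma_p => gp; rewrite /e; lra.
have C0 : 0 <= 2 `^ e / e by rewrite divr_ge0 ?powR_ge0// ltW.
have ln0 t : 0 < t -> 0 <= ln (1 + t).
  by move=> t0; apply: ln_ge0; rewrite lerDl ltW.
apply: (@kernel_moment_lty _ (1 + 2 `^ e / e) e) => //.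
- by rewrite addr_ge0.
- by apply: measurable_funTS; exact: measurable_ln1D.
- move=> t t0 _; rewrite lee_fin (@le_trans _ _ t)//.
    by apply: le_ln1Dx; rewrite (lt_trans _ t0)// ltrN10.
  by rewrite mulrDl mul1r lerDl mulr_ge0// ltW.
- move=> t t1; have t0 : 0 < t by exact: lt_le_trans t1.
  rewrite lee_fin (le_trans (ln_le_powR _ e0)) ?addr_gt0//.
  apply: (@le_trans _ _ ((2 * t) `^ e / e)).
    rewrite ler_pM2r ?invr_gt0//; apply: ge0_ler_powR; rewrite ?nnegrE ?(ltW e0)//.
    + by rewrite addr_ge0// ltW.
    + by rewrite mulr_ge0// ltW.
    + by rewrite mulrDl mul1r lerD2r.
  rewrite powRM ?(ltW t0)// mulrAC ler_wpM2r ?powR_ge0//.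
  by rewrite lerDr ler01.
Qed.

(** If the integral of this strictly positive function were 0, the whole half-line would be
    negligible. *)
Lemma flux_constant_gt0 : (forall t, 0 < t -> 0 < kappa t) -> (0 < flux_constant)%E.
Proof.
move=> kappa_gt0.
pose f t : \bar R := ((kappa t * t `^ (- a))%:E * (ln (1 + t))%:E)%E.
have f0 t : 0 < t -> (0 < f t)%E.
  move=> t0; rewrite /f -EFinM lte_fin !mulr_gt0 ?powR_gt0 ?kappa_gt0//.
  by rewrite ln_gt0// ltrDl.
have mf : measurable_fun P f.
  apply: emeasurable_funM; last by apply: measurable_funTS; exact: measurable_ln1D.
  by apply/measurable_EFinP; exact: kta_meas.
have fE : flux_constant = (\int[mu]_(t in P) `|f t|)%E.
  apply: eq_integral => t /set_mem; rewrite mem_posE => t0.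
  by rewrite gee0_abs// ltW// f0.
rewrite lt0e; apply/andP; split; last first.
  by rewrite fE; apply: integral_ge0 => t _; exact: abse_ge0.
apply/eqP; rewrite fE => /(ae_eq_integral_abs mu (measurable_itv _) mf)[N [mN N0 PN]].
have PN' : P `<=` N.
  move=> t Pt; apply: PN => /= /(_ Pt); move: Pt; rewrite mem_posE => t0.
  by apply/eqP; rewrite gt_eqF// f0.
have : (mu P <= mu N)%E by apply: le_measure => //; rewrite inE; [exact: measurable_itv|].
by rewrite N0 lebesgue_measure_itv/= ltry.
Qed.

Lemma integral_inv x y : 0 < x -> x < y ->
  (\int[mu]_(r in `]x, y]) (r^-1)%:E = (ln y - ln x)%:E)%E.
Proof.
move=> x0 xy.
have pos z : x <= z -> 0 < z by exact: lt_le_trans.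
have cinv z : 0 < z -> {for z, continuous (fun r : R => r^-1)}.
  by move=> z0; apply: inv_continuous; rewrite gt_eqF.
have cw : {within `[x, y], continuous (fun r : R => r^-1)}.
  apply/continuous_within_itvP => //; split.
  + by move=> z /[!in_itv]/= /andP[/ltW xz _]; apply: cinv; exact: pos.
  + by apply: cvg_at_right_filter; exact: cinv.
  + by apply: cvg_at_left_filter; apply: cinv; rewrite pos// ltW.
rewrite integral_itv_obnd_cbnd; last first.
  apply/measurable_EFinP; apply: measurable_funS measurable_inv_pos => //.
  by move=> r; rewrite mem_posE /= in_itv/= => /andP[/ltW/pos].
rewrite (@continuous_FTC2 _ _ (@ln R))//.
- split.
  + by move=> z /[!in_itv]/= /andP[/ltW xz _]; apply: ex_derive; apply: is_derive1_ln; exact: pos.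
  + by apply: cvg_at_right_filter; exact: continuous_ln.
  + by apply: cvg_at_left_filter; apply: continuous_ln; rewrite pos// ltW.
- move=> z /[!in_itv]/= /andP[/ltW xz _]; rewrite derive1E.
  by have [_ ->] := is_derive1_ln (pos _ xz).
Qed.

Definition flux_domain (rho : R) : set (R * R) :=
  [set z | z.1 <= rho /\ rho - z.1 < z.2].

Lemma flux_domain_measurable rho : measurable (flux_domain rho).
Proof.
have -> : flux_domain rho = (fun z : R * R => z.1) @^-1` `]-oo, rho] `&`
    (fun z : R * R => z.1 + z.2) @^-1` `]rho, +oo[.
  by apply/seteqP; split=> z; rewrite /flux_domain /= !in_itv/= andbT ltrBlDl.
apply: measurableI; rewrite -[X in measurable X]setTI.
  exact: measurable_fst.
by apply: measurable_funD.
Qed.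

(** The interval of integration depends on [r]; truncating the integrand instead gives a fixed
    domain, on which the integrals can be exchanged. As r <= rho, the interval lies in [P]. *)
Lemma integral_flux_section (h : R * R -> \bar R) rho r : r <= rho ->
  (\int[mu]_(s in `](rho - r)%R, +oo[) h (r, s) =
   \int[mu]_(s in P) (h \_ (flux_domain rho)) (r, s))%E.
Proof.
move=> rrho.
rewrite (_ : `]rho - r, +oo[%classic = P `&` `]rho - r, +oo[); last first.
  apply/seteqP; split=> s /=; rewrite !in_itv/= !andbT; last by move=> [].
  by move=> rs; split => //; rewrite (le_lt_trans _ rs)// subr_ge0.
rewrite integral_mkcondr; apply: eq_integral => s _.
rewrite !patchE; congr (if _ then _ else _).
by apply/idP/idP; rewrite !inE/= in_itv/= andbT /flux_domain /=; [move=> ->|move=> []].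
Qed.

Lemma flux_ray rho : 0 < rho ->
  (\int[mu]_(r in `]0%R, rho]) \int[mu]_(s in `](rho - r)%R, +oo[)
    (r * (r `^ gamma * kappa (s / r)) * (s `^ (- a) * r `^ (- a)))%:E =
  flux_constant)%E.
Proof.
move=> rho0.
pose h r s := r * (r `^ gamma * kappa (s / r)) * (s `^ (- a) * r `^ (- a)).
pose A := flux_domain rho.
pose H r s : \bar R := ((fun z : R * R => (h z.1 z.2)%:E) \_ A) (r, s).
have mh : measurable_fun (P `*` P) (fun z => (h z.1 z.2)%:E).
  apply/measurable_EFinP; apply: measurable_funM; last exact: measurable_funTS.
  by apply: measurable_funM; [exact: measurable_funTS|exact: measurable_homogeneous_kernel].
have mH : measurable_fun (P `*` P) (fun z => H z.1 z.2).
  have -> : (fun z => H z.1 z.2) = (fun z : R * R => (h z.1 z.2)%:E) \_ A.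
    by apply/funext => -[].
  apply/(measurable_restrict _ (flux_domain_measurable rho)); first exact: measurableX.
  by apply: measurable_funS mh => //; exact: measurableX.
have h0 r s : 0 < r -> 0 < s -> (0 <= (h r s)%:E)%E.
  by move=> r0 s0; rewrite lee_fin !mulr_ge0 ?powR_ge0 ?kappa_ge0 ?divr_gt0 ?(ltW r0).
have AE r s : (r, s) \in A = (r <= rho) && (rho - r < s)%R.
  by apply/idP/idP; rewrite inE /A /flux_domain /= => /andP.
transitivity (\int[mu]_(r in P) \int[mu]_(s in P) H r s)%E.
  rewrite (_ : `]0, rho]%classic = P `&` `]-oo, rho]); last first.
    by apply/seteqP; split=> r /=; rewrite !in_itv/= andbT; [move=> /andP[]|move=> [-> ->]].
  rewrite integral_mkcondr; apply: eq_integral => r /set_mem; rewrite mem_posE => r0.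
  rewrite patchE; case: ifPn => rrho; last first.
    rewrite integral0_eq// => s _; rewrite /H patchE AE.
    by case: ifPn => // /andP[rr _]; move: rrho; rewrite notin_setE /= in_itv/= rr.
  move: rrho => /set_mem; rewrite /= in_itv/= => rrho.
  exact: (integral_flux_section (fun z => (h z.1 z.2)%:E)).
rewrite tonelli_polar//; last first.
  by move=> r s r0 s0; rewrite /H patchE; case: ifPn => // _; exact: h0.
apply: eq_integral => t /set_mem; rewrite mem_posE => t0.
have t10 : 0 < 1 + t by rewrite addr_gt0.
have rt : rho / (1 + t) < rho by rewrite ltr_pdivrMr// ltr_pMr// ltrDl.
have -> : ln (1 + t) = ln rho - ln (rho / (1 + t)).
  by rewrite ln_div ?posrE// opprB addrCA subrr addr0.
rewrite -integral_inv ?divr_gt0//.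
rewrite (_ : `]rho / (1 + t), rho]%classic = P `&` `]rho / (1 + t), rho]); last first.
  apply/seteqP; split=> r /=; rewrite !in_itv/= ?andbT; last by move=> [].
  by move=> /andP[r1 ->]; rewrite r1; split => //; apply: lt_trans r1; rewrite divr_gt0.
rewrite integral_mkcondr -ge0_integralZl_EFin//; last 3 first.
- move=> r; rewrite mem_posE => r0; apply: erestrict_ge0 => x.
  by rewrite /= in_itv/= => /andP[x0 _]; rewrite lee_fin invr_ge0 ltW// (lt_trans _ x0)// divr_gt0.
- apply/(measurable_restrict _ _ _).1 => //; apply/measurable_EFinP.
  by apply: measurable_funS measurable_inv_pos => // r [].
- by rewrite mulr_ge0 ?powR_ge0 ?kappa_ge0.
apply: eq_integral => r /set_mem; rewrite mem_posE => r0.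
rewrite /H !patchE AE.
(* With s = r t, the condition r + s > rho becomes r > rho / (1 + t). *)
have -> : (r <= rho) && (rho - r < r * t) = (r \in `]rho / (1 + t), rho]%classic).
  by apply/idP/idP; rewrite inE/= in_itv/= ltr_pdivrMr// mulrDr mulr1 -ltrBlDl andbC.
case: ifPn => _; last by rewrite !mule0.
rewrite -!EFinM; congr EFin; rewrite /h powRM ?(ltW r0) ?(ltW t0)//.
rewrite (_ : r * t / r = t); last by field; rewrite gt_eqF.
(* One factor [r] is the size of x, the other the Jacobian of s = r t: the total exponent is 2 +
   gamma - 2a = -1. *)
have : r `^ 1 * r `^ 1 * r `^ gamma * r `^ (- a) * r `^ (- a) = r `^ (-1).
  by rewrite -!powRD_gt0//; congr (_ `^ _); field.
rewrite powRr1 ?(ltW r0)// powR_inv1 ?(ltW r0)// => rq.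
by rewrite -rq /=; ring.
Qed.

End kernel.

Lemma flux_constantZ (kappa : R -> R) (gamma k : R) : measurable_fun P kappa ->
  (forall t, 0 < t -> 0 <= kappa t) -> 0 <= k ->
  flux_constant (fun t => k * kappa t) gamma = (k%:E * flux_constant kappa gamma)%E.
Proof.
move=> mk kappa0 k0; rewrite /flux_constant -ge0_integralZl_EFin//.
- by apply: eq_integral => t _; rewrite -!EFinM !mulrA.
- move=> t; rewrite mem_posE => t0; rewrite -EFinM lee_fin !mulr_ge0 ?kappa0 ?powR_ge0//.
  by apply: ln_ge0; rewrite lerDl ltW.
- apply/measurable_EFinP; apply: measurable_funM; last first.
    by apply/measurable_EFinP; apply: measurable_funTS; exact: measurable_ln1D.
  by apply: measurable_funM => //; apply: measurable_funTS; exact: measurable_powR.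
Qed.

End ray_integrals.

(** * Measures carried by a continuous curve *)

Section borel_sets.
Context {R : realType} {T : ptopologicalType}.

Lemma open_borel (U : set T) : open U -> measurable (U : set (borel T)).
Proof. exact: sub_sigma_algebra. Qed.

Lemma closed_borel (C : set T) : closed C -> measurable (C : set (borel T)).
Proof.
by move=> cC; rewrite -[C]setCK; apply: measurableC; apply: open_borel; exact: closed_openC.
Qed.

Lemma continuous_borel_fun (f : T -> R) : continuous f ->
  measurable_fun [set: borel T] (f : borel T -> R).
Proof.
move=> cf; apply: (measurability (RGenOInfty.G (R := R))).
  exact: RGenOInfty.measurableE.
move=> _ [_ [a ->] <-]; rewrite setTI; apply: open_borel.
by apply: open_comp; [move=> x _; exact: cf|exact: interval_open].
Qed.

Lemma continuous_into_borel (f : R -> T) : continuous f ->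
  measurable_fun [set: R] (f : R -> borel T).
Proof.
move=> cf; apply: (@measurability _ _ _ (borel T) _ f (@open T)) => //.
move=> _ [U oU <-]; rewrite setTI; apply: open_measurable.
by apply: open_comp => // x _; exact: cf.
Qed.

End borel_sets.

Section ray_measure.
Context {R : realType} {T : ptopologicalType}.
Local Notation mu := (@lebesgue_measure R).
Local Notation P := (`]0%R, +oo[%classic : set R).
Variables (iota : R -> T) (w : R -> R).
Hypothesis iota_cont : continuous iota.
Hypothesis w_meas : measurable_fun P w.
Hypothesis w_ge0 : forall r, 0 < r -> 0 <= w r.
Local Open Scope ereal_scope.

Let iota_meas := continuous_into_borel iota_cont.

Let pre_meas (A : set (borel T)) : measurable A -> measurable (iota @^-1` A).
Proof. by move=> mA; rewrite -[X in measurable X]setTI; exact: iota_meas. Qed.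

(** [m] is the image under [iota] of the measure [w] dr on the half-line. Being a predicate, it
    applies both to the given [f] and to the constructed [F]. *)
Definition is_ray_measure (m : set (borel T) -> \bar R) :=
  forall A : set (borel T), measurable A ->
    m A = \int[mu]_(r in P `&` iota @^-1` A) (w r)%:E.

Lemma ray_measure_exists : exists m : {measure set (borel T) -> \bar R},
  is_ray_measure m.
Proof.
pose m (A : set (borel T)) := \int[mu]_(r in P `&` iota @^-1` A) (w r)%:E.
have w0 (A : set R) r : (P `&` A) r -> 0 <= (w r)%:E.
  by move=> [+ _]; rewrite mem_posE lee_fin; exact: w_ge0.
have m0 : m set0 = 0 by rewrite /m preimage_set0 setI0 integral_set0.
have mge0 A : 0 <= m A by apply: integral_ge0; exact: w0.
have msa : semi_sigma_additive m.
  move=> /= F mF tF mUF; apply: cvg_toP.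
    apply: ereal_nondecreasing_is_cvgn => i n in_.
    by apply: lee_sum_nneg_natr => // k _ _; exact: mge0.
  rewrite /m preimage_bigcup setI_bigcupr ge0_integral_bigcup//=.
  - by move=> k; apply: measurableI => //; exact: pre_meas.
  - apply/measurable_EFinP; apply: measurable_funS w_meas => //.
    by move=> r [k _ []].
  - by move=> r [k _ []]; rewrite mem_posE lee_fin => /w_ge0.
  - move/trivIsetP : tF => tF; apply/trivIsetP => i j _ _ ij.
    by rewrite setIACA setIid -preimage_setI tF// preimage_set0 setI0.
pose mM := isMeasure.Build _ _ _ m m0 mge0 msa.
by exists (HB.pack_for {measure set (borel T) -> \bar R} m mM).
Qed.

Variable m : {measure set (borel T) -> \bar R}.
Hypothesis mE : is_ray_measure m.

Import HBNNSimple.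

Let integral_indic_ray (A : set (borel T)) : measurable A ->
  \int[mu]_(r in P) ((\1_A (iota r))%:E * (w r)%:E) = m A.
Proof.
move=> mA; rewrite mE// integral_mkcondr; apply: eq_integral => r _.
rewrite patchE indicE; case: ifPn => [/set_mem rA|/negP rA].
  by rewrite mem_set// mul1e.
by rewrite memNset ?mul0e// => rA'; apply: rA; exact/mem_set.
Qed.

Let comp_meas (k : borel T -> \bar R) : measurable_fun setT k ->
  measurable_fun P (fun r => k (iota r) * (w r)%:E).
Proof.
move=> mk; apply: emeasurable_funM; last exact/measurable_EFinP.
by apply: measurable_funTS; exact: (measurableT_comp mk).
Qed.

Let integral_nnsfun_ray (f : {nnsfun (borel T) >-> R}) :
  \int[m]_x (f x)%:E = \int[mu]_(r in P) ((f (iota r))%:E * (w r)%:E).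
Proof.
transitivity (\sum_(y \in range f) (y%:E * m (f @^-1` [set y]))).
  by rewrite integralT_nnsfun sintegralE.
under [RHS]eq_integral => r _.
  rewrite fimfunE -fsumEFin// ge0_mule_fsuml; last first.
    by move=> y; rewrite EFinM nnfun_muleindic_ge0.
  over.
rewrite ge0_integral_fsum//; last 2 first.
- move=> y; apply: (comp_meas (k := fun x => (y * \1_(f @^-1` [set y]) x)%:E)).
  by apply/measurable_EFinP; apply: measurable_funM => //; exact: measurable_indic.
- move=> y r; rewrite mem_posE => r0.
  by apply: mule_ge0; [rewrite EFinM nnfun_muleindic_ge0|rewrite lee_fin w_ge0].
apply: eq_fsbigr => y /set_mem[x _ <-].
under [RHS]eq_integral do rewrite EFinM -muleA.
rewrite ge0_integralZl_EFin ?integral_indic_ray//.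
- move=> r; rewrite mem_posE => r0.
  by rewrite mule_ge0 ?lee_fin ?w_ge0.
- by apply: (comp_meas (k := fun x => (\1__ x)%:E)); apply/measurable_EFinP; exact: measurable_indic.
Qed.

(** Monotone limit of the formula for simple functions, which rests on that for indicators. *)
Let ge0_integral_ray (k : borel T -> \bar R) : measurable_fun setT k ->
  (forall x, 0 <= k x) ->
  \int[m]_x k x = \int[mu]_(r in P) (k (iota r) * (w r)%:E).
Proof.
move=> mk k0; pose f_ := nnsfun_approx measurableT mk.
have kE x : k x = limn (fun n => (f_ n x)%:E).
  by apply/esym/cvg_lim => //; apply: cvg_nnsfun_approx => // y _; exact: k0.
transitivity (limn (fun n => \int[m]_x (f_ n x)%:E)).
  rewrite -monotone_convergence//=.
  - by apply: eq_integral => x _; exact: kE.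
  - by move=> n; exact/measurable_EFinP.
  - by move=> n x _; rewrite lee_fin.
  - by move=> x _ a b ab; rewrite lee_fin//; exact/lefP/nd_nnsfun_approx.
under eq_fun do rewrite integral_nnsfun_ray.
rewrite -monotone_convergence//.
- apply: eq_integral => r /set_mem; rewrite mem_posE => r0; apply/cvg_lim => //.
  apply: cvgeZr => //; apply: cvg_nnsfun_approx => // y _; exact: k0.
- by move=> n; apply: (comp_meas (k := fun x => (f_ n x)%:E)); exact/measurable_EFinP.
- by move=> n r; rewrite mem_posE => r0; rewrite mule_ge0 ?lee_fin ?w_ge0.
- move=> r; rewrite mem_posE => r0 a b ab.
  apply: lee_wpmul2r; first by rewrite lee_fin w_ge0.
  by rewrite lee_fin; have /lefP/(_ (iota r)) := nd_nnsfun_approx measurableT mk ab.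
Qed.

Hypothesis hausT : hausdorff_space T.
Variable lambda : T -> R.
Hypothesis lambda_cont : continuous lambda.
Hypothesis iotaK : cancel iota lambda.

Let L : set (borel T) := iota @` P.

(** The curve consists of the points fixed by [iota \o lambda] whose [lambda] is positive; in a
    Hausdorff space the fixed points of a continuous map form a closed set. *)
Let L_meas : measurable L.
Proof.
have -> : L = (lambda : borel T -> R) @^-1` P `&` [set x : T | iota (lambda x) = x].
  apply/seteqP; split=> [_ [r Pr <-]|x [Px xE]].
    by rewrite /= iotaK; split => //; rewrite /= iotaK.
  by exists (lambda x).
apply: measurableI.
  by rewrite -[X in measurable X]setTI; exact: (continuous_borel_fun lambda_cont).
apply: closed_borel.
rewrite -[X in closed X]setCK; apply: open_closedC; rewrite openE => x /eqP xn.
move: hausT; rewrite open_hausdorff => /(_ _ _ xn)[[A B] /= [/set_mem xA /set_mem xB] [oA oB AB0]].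
have cx : {for x, continuous (iota \o lambda)}.
  by apply: continuous_comp; [exact: lambda_cont|exact: iota_cont].
have nA : nbhs x ((iota \o lambda) @^-1` A) by apply: cx; exact: open_nbhs_nbhs.
have nB : nbhs x B by exact: open_nbhs_nbhs.
rewrite /interior; apply: filterS (filterI nA nB) => y [/= Ay By] yE.
have : (A `&` B) y by split => //; rewrite -yE.
by rewrite (eqP AB0).
Qed.

Let L_ae : m (~` L) = 0.
Proof.
rewrite mE; last by apply: measurableC; exact: L_meas.
rewrite (_ : _ `&` _ = set0) ?integral_set0//.
by apply/seteqP; split=> r //= [Pr]; apply; exists r.
Qed.

(* No measurability is required: a lower integral only sees the part of a
   function living on the ray. *)
Let ge0_integral_L (k : borel T -> \bar R) : (forall x, 0 <= k x) ->
  \int[m]_x k x = \int[m]_(x in L) k x.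
Proof.
move=> k0; rewrite [RHS]integral_mkcond.
have kL0 x : 0 <= (k \_ L) x by apply: erestrict_ge0 => y _; exact: k0.
rewrite !ge0_integralTE//; apply/eqP; rewrite eq_le; apply/andP; split.
- apply: ge_ereal_sup => _ [h /= hk <-]; apply: ereal_sup_ubound.
  exists (proj_nnsfun h L_meas).
    move=> x; rewrite -[X in X%:E]/((proj_nnsfun h L_meas) x) -mrestrict !patchE.
    case: ifPn => _ //; exact: hk.
  rewrite -mrestrict.
  rewrite -(integral_nnsfun _ L_meas) -integralT_nnsfun.
  have -> : \int[m]_x (h x)%:E = \int[m]_(x in setT `\` ~` L) (h x)%:E.
    apply: ge0_negligible_integral => //.
    + by apply: measurableC; exact: L_meas.
    + exact/measurable_EFinP.
    + by move=> x _; rewrite lee_fin.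
  by rewrite setTD setCK.
- apply: ge_ereal_sup => _ [h /= hk <-]; apply: ereal_sup_ubound.
  exists h => //= x; apply: (le_trans (hk x)); rewrite patchE.
  by case: ifPn => // _; exact: k0.
Qed.

Let integral_L (k : borel T -> \bar R) : \int[m]_x k x = \int[m]_(x in L) k x.
Proof. by rewrite integralE [RHS]integralE !ge0_integral_L. Qed.

(** Measurability is asked of [k] along the curve, which is where kernels and test functions are
    under control. *)
Lemma integral_ray_measure (D : set (borel T)) (k : borel T -> \bar R) :
  measurable (P `&` iota @^-1` D) ->
  measurable_fun (P `&` iota @^-1` D) (k \o iota) ->
  \int[m]_(x in D) k x = \int[mu]_(r in P `&` iota @^-1` D) (k (iota r) * (w r)%:E).
Proof.
move=> mD mk; rewrite integral_mkcond [RHS]integral_mkcondr.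
(* [h] factors through the continuous [lambda], hence is Borel measurable, and it agrees with [k]
   cut off to [D] on the curve, which carries [m]. *)
pose h := ((k \o iota) \_ (P `&` iota @^-1` D)) \o (lambda : borel T -> R).
have mh : measurable_fun setT h.
  apply: measurableT_comp; last exact: continuous_borel_fun.
  by apply/(measurable_restrictT _ _).1.
have hE r : P r -> h (iota r) = (k \_ D) (iota r).
  move=> Pr; rewrite /h /= iotaK !patchE /=.
  have [rD|rD] := boolP (iota r \in D).
    by rewrite mem_set//; split => //; exact/set_mem.
  by rewrite memNset// => -[_ /= /mem_set]; exact/negP.
transitivity (\int[m]_x h x).
  rewrite (integral_L (k \_ D)) (integral_L h); apply: eq_integral => _ /set_mem[r Pr <-].
  by rewrite hE.
transitivity (\int[mu]_(r in P) (h (iota r) * (w r)%:E)); last first.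
  apply: eq_integral => r /set_mem Pr; rewrite hE// !patchE.
  have [rD|rD] := boolP (iota r \in D).
    by rewrite mem_set//; exact/set_mem.
  by rewrite memNset ?mul0e// => /mem_set; exact/negP.
rewrite integralE [RHS]integralE.
rewrite (ge0_integral_ray (measurable_funepos mh))// (ge0_integral_ray (measurable_funeneg mh))//.
congr (_ - _); apply: eq_integral => r /set_mem; rewrite mem_posE => r0.
  rewrite muleC -[RHS]/((fun r => h (iota r) * (w r)%:E)^\+ r) !funeposE.
  by rewrite maxe_pMr ?lee_fin ?w_ge0// mule0 muleC.
rewrite muleC -[RHS]/((fun r => h (iota r) * (w r)%:E)^\- r) !funenegE.
by rewrite maxe_pMr ?lee_fin ?w_ge0// mule0 muleN muleC.
Qed.

End ray_measure.

(** * Identification of a measure from its integrals *)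

Section open_approximation.
Context {R : realType} {V : normedModType R}.

(** Take min(1, n dist(x, ~U)). A nonempty complement makes the distance finite, and openness makes
    it positive on [U]. *)
Lemma open_indicator_approximation (U : set V) : open U -> (~` U) !=set0 ->
  exists phi : nat -> V -> R,
    [/\ forall n, continuous (phi n),
        forall n x, 0 <= phi n x,
        forall n x, ~ U x -> phi n x = 0,
        forall x, {homo phi ^~ x : n m / (n <= m)%N >-> n <= m} &
        forall x, U x -> phi n x @[n --> \oo] --> (1 : R)].
Proof.
move=> oU [a Ua]; pose e x := edist_inf (~` U) x.
have e_fin x : e x \is a fin_num.
  rewrite ge0_fin_numE ?edist_inf_ge0//.
  apply: (@le_lt_trans _ _ (edist (x, a))).
    by apply: ereal_inf_lbound; exists a.
  rewrite -ge0_fin_numE ?edist_ge0//; apply/edist_finP; exists (`|x - a| + 1).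
    by rewrite ltr_wpDl.
  by rewrite -ball_normE /= ltrDl.
pose dist x := fine (e x).
have dist_ge0 x : 0 <= dist x by rewrite fine_ge0// edist_inf_ge0.
exists (fun n x => Num.min 1 (n%:R * dist x)); split.
- move=> n x; apply: (@continuous_min _ _ (cst 1) (fun x => n%:R * dist x)).
    exact: cst_continuous.
  apply: cvgMr; apply: fine_cvg; rewrite fineK//.
  exact: edist_inf_continuous.
- by move=> n x; rewrite le_min ler01 mulr_ge0.
- move=> n x Ux; rewrite /dist /e edist_inf0//= mulr0.
  by rewrite min_r.
- by move=> x n m nm; rewrite le_min !ge_min lexx/= ler_wpM2r ?ler_nat ?orbT.
- move=> x Ux.
  have dx : 0 < dist x.
    have /nbhs_ballP[r /= r0 rU] : nbhs x U by exact: open_nbhs_nbhs.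
    apply: (lt_le_trans r0); rewrite -lee_fin fineK//.
    apply: le_ereal_inf_tmp => _ [y Uy <-]; rewrite leNgt; apply/negP => /edist_lt_ball xy.
    exact/Uy/rU.
  apply: (@cvg_trans _ ((1 : R) @[n --> \oo])); last exact: cvg_cst.
  apply: near_eq_cvg; near=> n; rewrite min_l//.
  rewrite -ler_pdivrMr// mul1r.
  near: n; exact: nbhs_infty_ger.
Unshelve. all: by end_near. Qed.

End open_approximation.

Section orthant.
Context {R : realType} {d : nat}.
Implicit Types (x y theta : 'rV[R]_d).

Lemma l1norm_continuous : continuous (@l1norm R d).
Proof.
suff H (s : seq 'I_d) : continuous (fun x : 'rV[R]_d => \sum_(j <- s) x 0 j) by exact: H.
elim: s => [|j s ih] x.
  rewrite (_ : (fun _ => _) = (fun=> 0 : R)); first exact: (@cst_continuous _ _ (0 : R)).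
  by apply/funext => y; rewrite big_nil.
rewrite (_ : (fun _ => _) = fun x : 'rV[R]_d => x 0 j + \sum_(j <- s) x 0 j).
  by apply: continuousD; [exact: (@coord_continuous R 1 d 0 j x)|exact: ih].
by apply/funext => y; rewrite big_cons.
Qed.

Lemma l1normZ (c : R) x : l1norm (c *: x) = c * l1norm x.
Proof. by rewrite /l1norm mulr_sumr; apply: eq_bigr => j _; rewrite mxE. Qed.

Lemma Rdstar_l1norm_gt0 x : Rdstar x -> 0 < l1norm x.
Proof.
move=> [x0 xn0]; rewrite lt_neqAle sumr_ge0 ?andbT; last by move=> j _; exact: x0.
apply/eqP => /esym/eqP; rewrite psumr_eq0; last by move=> j _; exact: x0.
move=> /allP x0'; apply: xn0; apply/funext => i; apply/funext => j; rewrite ord1; apply/eqP/x0'.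
by rewrite mem_index_enum.
Qed.

(** Trades [x <> 0] for an open condition on [l1norm], so that [Rdstar] is a closed set intersected
    with an open one. *)
Lemma RdstarP x : Rdstar x <-> (forall j, 0 <= x 0 j) /\ 0 < l1norm x.
Proof.
split=> [Rx|[x0 xn0]]; first by split; [exact: Rx.1|exact: Rdstar_l1norm_gt0].
by split => // xE; move: xn0; rewrite /l1norm big1 ?ltxx// => j _; rewrite xE.
Qed.

Lemma RdstarZ (c : R) x : 0 < c -> Rdstar x -> Rdstar (c *: x).
Proof.
move=> c0 /RdstarP[x0 xn0]; apply/RdstarP; split; last by rewrite l1normZ mulr_gt0.
by move=> j; rewrite mxE mulr_ge0// ltW.
Qed.

Lemma closed_orthant : closed [set x : 'rV[R]_d | forall j, 0 <= x 0 j].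
Proof.
have -> : [set x : 'rV[R]_d | forall j, 0 <= x 0 j] =
    \bigcap_(j in setT) [set x : 'rV[R]_d | 0 <= x 0 j].
  by apply/seteqP; split=> [x x0 j _|x x0 j]; [exact: x0|exact: (x0 j I)].
apply: closed_bigI => j _.
apply: (@closed_comp _ _ (fun x : 'rV[R]_d => x 0 j) [set t | 0 <= t]); last exact: closed_ge.
by move=> x _; exact: coord_continuous.
Qed.

Lemma Rdstar_measurable : measurable (@Rdstar R d : set (borel 'rV[R]_d)).
Proof.
have -> : @Rdstar R d = [set x : 'rV[R]_d | forall j, 0 <= x 0 j] `&`
    @l1norm R d @^-1` `]0, +oo[.
  apply/seteqP; split=> x; first by move=> /RdstarP[x0 xn0]; split => //=; rewrite in_itv/= andbT.
  by rewrite /= in_itv/= andbT => -[x0 xn0]; apply/RdstarP.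
apply: measurableI; first by apply: closed_borel; exact: closed_orthant.
apply: open_borel; apply: open_comp; last exact: interval_open.
by move=> x _; exact: l1norm_continuous.
Qed.

Lemma closed_simplex : closed (@simplex R d).
Proof.
have -> : @simplex R d = [set x : 'rV[R]_d | forall j, 0 <= x 0 j] `&`
    @l1norm R d @^-1` [set 1].
  apply/seteqP; split=> x [/= x0 x1]; first by split => //; exact: x0.1.
  by split => //; apply/RdstarP; rewrite x1.
apply: closedI; first exact: closed_orthant.
by apply: closed_comp; [move=> x _; exact: l1norm_continuous|exact: closed_eq].
Qed.

(** Open in the whole space, where [l1norm] is a signed sum and bounds nothing; only the trace on
    the orthant lies in a compact set, [cone_annulus n]. *)
Definition annulus (n : nat) : set 'rV[R]_d :=
  [set x : 'rV[R]_d | n.+1%:R^-1 < l1norm x < n.+1%:R].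

Definition cone_annulus (n : nat) : set 'rV[R]_d :=
  [set x : 'rV[R]_d | (forall j, 0 <= x 0 j) /\ n.+1%:R^-1 <= l1norm x <= n.+1%:R].

Lemma annulus_open n : open (annulus n).
Proof.
have -> : annulus n = @l1norm R d @^-1` `]n.+1%:R^-1, n.+1%:R[.
  by apply/seteqP; split=> x; rewrite /annulus /= in_itv.
by apply: open_comp; [move=> x _; exact: l1norm_continuous|exact: interval_open].
Qed.

Lemma cone_annulus_Rdstar n : cone_annulus n `<=` @Rdstar R d.
Proof.
move=> x [x0 /andP[nx _]]; split => // xE; move: nx.
by rewrite /l1norm big1 => [|j _]; [rewrite leNgt invr_gt0 ltr0n|rewrite xE].
Qed.

Lemma cone_annulus_compact n : compact (cone_annulus n).
Proof.
apply: bounded_closed_compact.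
  exists n.+1%:R; split => // M nM x [x0 /andP[_ xn]].
  rewrite /= [leLHS]/Num.Def.normr/= mx_normrE; apply: bigmax_le => [|[i j] _ /=].
    by rewrite (le_trans _ (ltW nM)).
  rewrite ord1 ger0_norm// (le_trans _ (ltW nM))// (le_trans _ xn)//.
  by rewrite /l1norm (bigD1 j)//= lerDl sumr_ge0.
have -> : cone_annulus n = [set x : 'rV[R]_d | forall j, 0 <= x 0 j] `&`
    @l1norm R d @^-1` `[n.+1%:R^-1, n.+1%:R].
  by apply/seteqP; split=> x; rewrite /cone_annulus /= in_itv.
apply: closedI; first exact: closed_orthant.
apply: closed_comp; [move=> x _; exact: l1norm_continuous|exact: interval_closed].
Qed.

Lemma annulus_nd : nondecreasing_seq annulus.
Proof.
move=> n m nm; apply/subsetPset => x /andP[nx xn]; apply/andP; split.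
  by apply: le_lt_trans nx; rewrite lef_pV2 ?posrE// ler_nat ltnS.
by apply: lt_le_trans xn _; rewrite ler_nat ltnS.
Qed.

Lemma Rdstar_sub_annulus : @Rdstar R d `<=` \bigcup_n annulus n.
Proof.
move=> x /Rdstar_l1norm_gt0 x0.
exists (maxn (Num.truncn (l1norm x)^-1) (Num.truncn (l1norm x))) => //.
apply/andP; split.
  rewrite invf_plt ?posrE//; apply: lt_le_trans (Num.Theory.truncnS_gt _) _.
  by rewrite ler_nat ltnS leq_maxl.
apply: lt_le_trans (Num.Theory.truncnS_gt _) _.
by rewrite ler_nat ltnS leq_maxr.
Qed.

End orthant.

Section ray_uniqueness.
Context {R : realType} {d : nat}.
Local Notation mu := (@lebesgue_measure R).
Local Notation P := (`]0%R, +oo[%classic : set R).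
Variable theta : 'rV[R]_d.
Hypothesis theta_simplex : simplex theta.

Definition ray (r : R) : 'rV[R]_d := r *: theta.

Lemma rayE r : ray r = r *: theta. Proof. by []. Qed.

Lemma ray_continuous : continuous ray.
Proof. by move=> r; apply: cvgZr_tmp; exact: cvg_id. Qed.

Lemma l1norm_ray : cancel ray (@l1norm R d).
Proof. by move=> r; rewrite /ray l1normZ theta_simplex.2 mulr1. Qed.

Lemma ray_Rdstar r : 0 < r -> Rdstar (ray r).
Proof. by move=> r0; apply: RdstarZ => //; exact: theta_simplex.1. Qed.

(** The increasing annuli cover [Rdstar], and the rest of the space has measure 0. *)
Lemma measure_cvg_annulus (m : {measure set (borel 'rV[R]_d) -> \bar R}) (A : set (borel 'rV[R]_d)) :
  m (~` @Rdstar R d) = 0%E -> measurable A ->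
  m (A `&` annulus n) @[n --> \oo] --> m A.
Proof.
move=> m0 mA.
have ma n : measurable (annulus n : set (borel 'rV[R]_d)).
  by apply: open_borel; exact: annulus_open.
have mU : measurable (\bigcup_n annulus n : set (borel 'rV[R]_d)) by exact: bigcupT_measurable.
have -> : m A = m (\bigcup_n (A `&` annulus n)).
  rewrite -setI_bigcupr; set Q := \bigcup_n _.
  rewrite -[in LHS](setUIDK A Q) measureU//; last 3 first.
  - exact: measurableI.
  - exact: measurableD.
  - by apply/seteqP; split=> x //= [[_ Qx] [_]]; apply.
  rewrite [X in _ + X](_ : _ = 0%E) ?addr0//.
  apply/eqP; rewrite -measure_le0 -m0; apply: le_measure; rewrite ?inE.
  - exact: measurableD.
  - by apply: measurableC; exact: Rdstar_measurable.
  - by move=> x [_ Qx] /Rdstar_sub_annulus.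
apply: nondecreasing_cvg_mu.
- by move=> n; exact: measurableI.
- by apply: bigcupT_measurable => n; exact: measurableI.
- by move=> n k nk; apply/subsetPset; apply: setIS; apply/subsetPset; exact: annulus_nd.
Qed.

Variables (f : {measure set (borel 'rV[R]_d) -> \bar R}) (c a : R).
Hypothesis c_ge0 : 0 <= c.
Hypothesis f_radon : radon_on (@Rdstar R d) f.
Hypothesis f_ray : forall phi : 'rV[R]_d -> R, Cc_on (@Rdstar R d) phi ->
  (\int[f]_(x in @Rdstar R d) (phi x)%:E =
   c%:E * \int[mu]_(r in `]0%R, +oo[) (phi (r *: theta) * r `^ a)%:E)%E.

Let w r := c * r `^ a.

Let w_meas : measurable_fun P w.
Proof. by apply: measurable_funM => //; apply: measurable_funTS; exact: measurable_powR. Qed.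

Let w_ge0 r : 0 < r -> 0 <= w r.
Proof. by move=> _; rewrite mulr_ge0 ?powR_ge0. Qed.

Let restrict_Rdstar (A : set (borel 'rV[R]_d)) : measurable A ->
  f (A `&` @Rdstar R d) = f A.
Proof.
move=> mA; have mR := @Rdstar_measurable R d.
rewrite -[in RHS](setUIDK A (@Rdstar R d)) measureU//; last 3 first.
- exact: measurableI.
- exact: measurableD.
- by apply/seteqP; split=> x //= [[_ Qx] [_]]; apply.
rewrite [X in _ + X](_ : _ = 0%E) ?addr0//.
apply/eqP; rewrite -measure_le0 -f_radon.1; apply: le_measure; rewrite ?inE.
- exact: measurableD.
- exact: measurableC.
- by move=> x [].
Qed.

(** The indicator of [U] is an increasing limit of continuous functions vanishing off [U]. On
    [Rdstar] these are supported in the compact [cone_annulus n], so [f_ray] applies to them, and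
    monotone convergence passes to the limit on both sides. The origin, outside every annulus, shows
    that [U] is not the whole space. *)
Let f_open (U : set 'rV[R]_d) n : open U -> U `<=` annulus n ->
  f U = (\int[mu]_(r in P `&` ray @^-1` U) (w r)%:E)%E.
Proof.
move=> oU UO; have mU := open_borel oU.
have [|phi [phi_cont phi_ge0 phi_out phi_nd phi_cvg]] := open_indicator_approximation oU.
  exists 0; move=> /UO /andP[+ _]; rewrite /l1norm big1 => [|j _]; last by rewrite mxE.
  by rewrite ltNge invr_ge0 ler0n.
have phi_limit x : (\1_U x)%:E = limn (fun k => (phi k x)%:E).
  apply/esym/cvg_lim => //; apply: cvg_EFin; first exact: nearW.
  rewrite indicE; case: (boolP (x \in U)) => [/set_mem Ux|/negP Ux]; first exact: phi_cvg.
  by apply: cvg_near_cst; apply: nearW => k /=; rewrite phi_out// => /mem_set.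
have phiC k : Cc_on (@Rdstar R d) (phi k).
  split; first exact: continuous_subspaceT.
  exists (cone_annulus n); split.
  - exact: cone_annulus_compact.
  - exact: cone_annulus_Rdstar.
  - move=> x Rx Cx; apply: phi_out => /UO /andP[nx xn]; apply: Cx.
    by split; [exact: Rx.1|rewrite !ltW].
transitivity (\int[f]_(x in @Rdstar R d) (\1_U x)%:E)%E.
  by rewrite integral_indic ?restrict_Rdstar//; exact: Rdstar_measurable.
transitivity (limn (fun k => \int[f]_(x in @Rdstar R d) (phi k x)%:E))%E.
  rewrite -monotone_convergence//.
  - by apply: eq_integral => x _; exact: phi_limit.
  - exact: Rdstar_measurable.
  - by move=> k; apply/measurable_EFinP; apply: measurable_funTS; exact: continuous_borel_fun.
  - by move=> k x _; rewrite lee_fin.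
  - by move=> x _ k l kl; rewrite lee_fin; exact: phi_nd.
have pm k : measurable_fun P (fun r => (phi k (ray r) * r `^ a)%:E).
  apply/measurable_EFinP; apply: measurable_funM; last exact: measurable_funTS.
  apply: measurable_funTS; apply: continuous_measurable_fun => r.
  by apply: continuous_comp; [exact: ray_continuous|exact: phi_cont].
have phi_int k : (\int[f]_(x in @Rdstar R d) (phi k x)%:E =
    \int[mu]_(r in P) (c%:E * (phi k (ray r) * r `^ a)%:E))%E.
  rewrite f_ray// ge0_integralZl_EFin//; last exact: pm.
  by move=> r _; rewrite lee_fin mulr_ge0 ?powR_ge0.
under eq_fun do rewrite phi_int.
rewrite -monotone_convergence//.
- rewrite integral_mkcondr; apply: eq_integral => r _; rewrite patchE.
  apply/cvg_lim => //.
  case: ifPn => [/set_mem rU|/negP rU]; last first.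
    apply: cvg_near_cst; apply: nearW => k /=.
    by rewrite phi_out ?mul0r ?mule0// => Ur; apply: rU; exact/mem_set.
  apply: cvg_EFin; first exact: nearW.
  rewrite /w -[X in _ --> c * X]mul1r; apply: cvgM; first exact: cvg_cst.
  by apply: cvgM; [exact: phi_cvg|exact: cvg_cst].
- by move=> k; apply: measurable_funeM; exact: pm.
- by move=> k r _; rewrite mule_ge0 ?lee_fin// mulr_ge0 ?powR_ge0.
- move=> r _ k l kl; rewrite lee_wpmul2l ?lee_fin// ler_wpM2r ?powR_ge0//.
  exact: phi_nd.
Qed.

(** On each annulus the two measures are finite and agree on open sets, a family stable under
    intersection that generates the Borel sets; then the annuli grow. *)
Lemma is_ray_measure_unique : is_ray_measure ray w f.
Proof.
have [m mE] := ray_measure_exists ray_continuous w_meas w_ge0.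
suff fm A : measurable A -> f A = m A by move=> A mA; rewrite fm// mE.
move=> mA.
have m0 : m (~` @Rdstar R d) = 0%E.
  rewrite mE; last by apply: measurableC; exact: Rdstar_measurable.
  rewrite (_ : _ `&` _ = set0) ?integral_set0//.
  by apply/seteqP; split=> r //= -[]; rewrite in_itv/= andbT => /ray_Rdstar.
have fo : f (~` @Rdstar R d) = 0%E by exact: f_radon.1.
have := measure_cvg_annulus m0 mA; have := measure_cvg_annulus fo mA.
suff -> : (fun n => f (A `&` annulus n)) = (fun n => m (A `&` annulus n)).
  by move=> h1 h2; exact: cvg_unique h1 h2.
apply/funext => n.
have mO : measurable (annulus n : set (borel 'rV[R]_d)).
  by apply: open_borel; exact: annulus_open.
apply: (@measure_unique _ _ (borel 'rV[R]_d) (@open 'rV[R]_d) (fun=> setT) _ _ _ _ (mrestr f mO) (mrestr m mO)) => //.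
- by move=> U V oU oV; exact: openI.
- by move=> _; exact: openT.
- by rewrite bigcup_const.
- move=> U oU; rewrite /= /mrestr.
  have oUO : open (U `&` annulus n) by apply: openI => //; exact: annulus_open.
  rewrite (f_open oUO (@subIsetr _ _ _)) mE//.
  exact: open_borel.
(* Finiteness on the annulus: its trace on [Rdstar] lies in a compact subset of [Rdstar], and [f] is
   Radon. *)
- move=> _; rewrite /= /mrestr setTI -restrict_Rdstar//.
  apply: (@le_lt_trans _ _ (f (cone_annulus n : set 'rV[R]_d))); last first.
    exact: (f_radon.2 _ (@cone_annulus_compact R d n) (@cone_annulus_Rdstar R d n)).
  apply: le_measure; rewrite ?inE.
  - by apply: measurableI => //; exact: Rdstar_measurable.
  - apply: closed_borel; apply: compact_closed; last exact: cone_annulus_compact.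
    exact: norm_hausdorff.
  - by move=> x [/andP[nx xn] Rx]; split; [exact: Rx.1|rewrite !ltW].
Qed.

End ray_uniqueness.

(** * Test functions along a ray *)

Section signed_integrals.
Local Open Scope ereal_scope.
Context {R : realType}.

Lemma ge0_muleBr (k : R) (x y : \bar R) : (0 < k)%R -> 0 <= x -> 0 <= y ->
  k%:E * (x - y) = k%:E * x - k%:E * y.
Proof.
move=> k0; case: x => [x||]; case: y => [y||] //= _ _.
- by rewrite -EFinB -!EFinM -EFinB mulrBr.
- by rewrite addeNy gt0_muleNy ?lte_fin// gt0_muley ?lte_fin.
- by rewrite gt0_muley ?lte_fin.
- by rewrite gt0_muleNy ?lte_fin// gt0_muley ?lte_fin.
Qed.

(** A positive real factor comes out of a signed integral even when both parts are infinite. This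
    moves the outer density inside inner integrals whose convergence is not yet known. *)
Lemma gt0_integralZl d (T : measurableType d) (m : {measure set T -> \bar R})
    (D : set T) (h : T -> \bar R) (k : R) :
  measurable D -> measurable_fun D h -> (0 < k)%R ->
  \int[m]_(x in D) (k%:E * h x) = k%:E * \int[m]_(x in D) h x.
Proof.
move=> mD mh k0; rewrite integralE [in RHS]integralE.
rewrite (ge0_funeposM _ (ltW k0)) (ge0_funenegM _ (ltW k0)).
rewrite !ge0_integralZl_EFin ?(ltW k0)//; [|exact: measurable_funeneg|exact: measurable_funepos].
by apply/esym/ge0_muleBr => //; exact: integral_ge0.
Qed.

Lemma measurable_integral_on d1 d2 (X : measurableType d1) (Y : measurableType d2)
    (m2 : {sigma_finite_measure set Y -> \bar R}) (D : set X) (E : set Y)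
    (H : X -> Y -> \bar R) :
  measurable D -> measurable E -> measurable_fun (D `*` E) (fun z => H z.1 z.2) ->
  measurable_fun D (fun x => \int[m2]_(y in E) H x y).
Proof.
move=> mD mE mH.
rewrite (_ : (fun _ => _) = (fun x => \int[m2]_(y in E) (H x)^\+ y - \int[m2]_(y in E) (H x)^\- y)).
  apply: emeasurable_funB; apply: measurable_tonelli_on => //.
  - have := measurable_funepos mH; apply: eq_measurable_fun => z _.
    by rewrite !funeposE.
  - have := measurable_funeneg mH; apply: eq_measurable_fun => z _.
    by rewrite !funenegE.
by apply/funext => x; rewrite -integralE.
Qed.

End signed_integrals.

Section compactness.
Context {R : realType}.
Local Notation P := (`]0%R, +oo[%classic : set R).

Lemma compact_pos_bounds (A : set R) : compact A -> A `<=` P ->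
  exists m M : R, [/\ 0 < m, m <= M & A `<=` `[m, M]].
Proof.
move=> cA AP; have [M0 [_ AM0]] := compact_bounded cA.
have clA : closed A by apply: compact_closed => //; exact: norm_hausdorff.
have /nbhs_ballP[e /= e0 eA] : nbhs (0 : R) (~` A).
  apply: open_nbhs_nbhs; split; first exact: closed_openC.
  by move=> /AP; rewrite mem_posE ltxx.
exists e, (Num.max e (M0 + 1)); split => //; first by rewrite le_max lexx.
move=> x Ax; have x0 : 0 < x by have := AP x Ax; rewrite mem_posE.
rewrite /= in_itv/=; apply/andP; split.
  rewrite leNgt; apply/negP => xe; apply: (eA x) => //.
  by rewrite -ball_normE /= sub0r normrN gtr0_norm.
rewrite le_max; apply/orP; right.
by have := AM0 (M0 + 1); rewrite ltrDl ltr01 => /(_ isT x Ax) /=; rewrite gtr0_norm.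
Qed.

(** [P] is open in R and is sent into [A], so continuity relative to [A] becomes ordinary continuity
    along the curve, even if the curve runs in a face of the orthant. *)
Lemma within_continuous_comp_pos {T : topologicalType} (A : set T) (F : T -> R) (h : R -> T) :
  {within A, continuous F} -> {in P, continuous h} -> (forall r, 0 < r -> A (h r)) ->
  {in P, continuous (F \o h)}.
Proof.
move=> /subspace_continuousP cF ch hA r rP.
have r0 : 0 < r by move: rP; rewrite inE mem_posE.
apply: cvg_trans (cF (h r) (hA r r0)) => U /= hU.
have := ch r rP; move=> /(_ _ hU) /=.
have : nbhs r P by apply: open_nbhs_nbhs; split; [exact: interval_open|rewrite mem_posE].
apply: filterS2 => s; rewrite mem_posE => s0 /=; apply; exact: hA.
Qed.

Lemma continuous_in_pos_measurable (h : R -> R) : {in P, continuous h} -> measurable_fun P h.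
Proof. by move=> ch; apply: open_continuous_measurable_fun => //; exact: interval_open. Qed.

End compactness.

(** * Support and Lipschitz bound of a test function along the ray *)

Section C1c_ray.
Context {R : realType} {d : nat}.
Local Notation P := (`]0%R, +oo[%classic : set R).
Variable theta : 'rV[R]_d.
Hypothesis theta_simplex : simplex theta.
Variable phi : 'rV[R]_d -> R.
Hypothesis phiC : C1c phi.
Local Notation ray := (ray theta).

Let dphi r := 'D_theta (phi : 'rV[R]_d -> R^o) (ray r).

Let phi_diff r : 0 < r -> differentiable (phi : 'rV[R]_d -> R^o) (ray r).
Proof.
move=> r0; have [[U [_ RU Uphi]] _] := phiC.
by have [] := Uphi (ray r) (RU _ (ray_Rdstar theta_simplex r0)).
Qed.

Let is_derive_ray (r : R) : 0 < r -> is_derive (r : R^o) 1 (phi \o ray : R -> R^o) (dphi r).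
Proof.
move=> r0; have dp : derivable (phi : 'rV[R]_d -> R^o) (ray r) theta.
  by apply: diff_derivable; exact: phi_diff.
have E : (fun h : R => h^-1 *: (((phi \o ray : R -> R^o) \o shift r) (h *: 1) - (phi \o ray) r)) =
    (fun h : R => h^-1 *: (((phi : 'rV[R]_d -> R^o) \o shift (ray r)) (h *: theta) - phi (ray r))).
  by apply/funext => h /=; rewrite /ray scalerDl /GRing.scale /= mulr1.
by split; rewrite /derivable /dphi /derive E.
Qed.

(** Differentiability gives the derivative along theta as the combination of the partial derivatives
    with coefficients theta_j, and these are continuous. *)
Let dphi_continuous : {in P, continuous dphi}.
Proof.
move=> r; rewrite inE mem_posE => r0.
have [[U [_ RU Uphi]] _] := phiC.
pose D (j : 'I_d) z := 'D_(delta_mx 0 j) (phi : 'rV[R]_d -> R^o) z.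
have Dcont j : {for r, continuous (D j \o ray)}.
  apply: continuous_comp; first exact: ray_continuous.
  exact: (Uphi _ (RU _ (ray_Rdstar theta_simplex r0))).2.
have E s : 0 < s -> dphi s = \sum_(j < d) theta 0 j * D j (ray s).
  move=> s0; rewrite /dphi deriveE; last exact: phi_diff.
  rewrite [X in 'd _ _ X](row_sum_delta theta) linear_sum; apply: eq_bigr => j _.
  rewrite linearZ; congr (_ * _); rewrite /D deriveE//; exact: phi_diff.
have : {for r, continuous (fun s => \sum_(j < d) theta 0 j * D j (ray s))}.
  suff H (s : seq 'I_d) : {for r, continuous (fun u => \sum_(j <- s) theta 0 j * D j (ray u))} by exact: H.
  elim: s => [|j s ih].
    rewrite (_ : (fun _ => _) = (fun=> 0 : R)); first exact: (@cst_continuous _ _ (0 : R)).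
    by apply/funext => y; rewrite big_nil.
  rewrite (_ : (fun _ => _) = fun u => theta 0 j * D j (ray u) + \sum_(j <- s) theta 0 j * D j (ray u)).
    apply: (@continuousD _ R^o); last exact: ih.
    by apply: continuousM; [exact: cst_continuous|exact: Dcont].
  by apply/funext => y; rewrite big_cons.
move=> ct; rewrite /continuous_at (E r r0); apply: cvg_trans ct; apply: near_eq_cvg.
near=> s; rewrite E//; near: s; exact: lt_nbhsr.
Unshelve. all: by end_near. Qed.

Lemma C1c_continuous_ray : {in P, continuous (phi \o ray)}.
Proof.
move=> r; rewrite inE mem_posE => r0.
apply: (@differentiable_continuous _ R^o R^o); apply/derivable1_diffP.
exact: (@ex_derive _ _ _ _ _ _ _ (is_derive_ray r0)).
Qed.

(** The [l1norm] image of the compact support is a compact set of positive reals, and [l1norm] is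
    the parameter of the ray. *)
Lemma C1c_ray_support : exists m M : R, [/\ 0 < m, m <= M &
  forall r, 0 < r -> ~~ (m <= r <= M) -> phi (ray r) = 0].
Proof.
have [_ [C [cC CR Cphi]]] := phiC.
have cN : compact (@l1norm R d @` C).
  by apply: continuous_compact => //; apply: continuous_subspaceT; exact: l1norm_continuous.
have [|m [M [m0 mM CmM]]] := compact_pos_bounds cN.
  by move=> _ [x /CR Rx <-]; rewrite mem_posE Rdstar_l1norm_gt0.
exists m, M; split => // r r0 rmM; apply: Cphi; first exact: ray_Rdstar.
move=> Cr; move/negP : rmM; apply.
by have /= := CmM r; rewrite in_itv; apply; exists (ray r) => //; exact: l1norm_ray.
Qed.

(** The derivative is bounded on [m, M] by compactness and vanishes elsewhere; the mean value
    theorem concludes. *)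
Lemma C1c_ray_lipschitz : exists2 L : R, 0 <= L &
  forall r s, 0 < r -> 0 < s -> `|phi (ray r) - phi (ray s)| <= L * `|r - s|.
Proof.
have [m [M [m0 mM out]]] := C1c_ray_support.
have pos z : m <= z -> 0 < z by exact: lt_le_trans.
have [B [_ dB]] : bounded_set (dphi @` `[m, M]).
  apply: compact_bounded; apply: continuous_compact; last exact: segment_compact.
  apply: continuous_in_subspaceT => r; rewrite inE/= in_itv/= => /andP[/pos r0 _].
  by apply: dphi_continuous; rewrite inE mem_posE.
(* Boundedness provides every constant strictly above [B], hence [B + 1]; the maximum makes [L]
   nonnegative. *)
pose L := Num.max 0 (B + 1).
have L0 : 0 <= L by rewrite le_max lexx.
have dL r : 0 < r -> `|dphi r| <= L.
  move=> r0; have [/andP[mr rM]|rmM] := boolP (m <= r <= M).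
    rewrite /L le_max; apply/orP; right; apply: (dB (B + 1)); first by rewrite ltrDl.
    by exists r => //=; rewrite in_itv/= mr.
  suff -> : dphi r = 0 by rewrite normr0.
  have [_ <-] := is_derive_ray r0.
  (* Off [m, M] the function is 0 on a whole neighbourhood of [r], hence so is its derivative at
     [r]. *)
  rewrite (@near_eq_derive _ _ _ _ (cst 0)) ?derive_cst//.
  move: rmM; rewrite negb_and -!ltNge => /orP[rm|Mr].
    near=> s; rewrite /= out//; first by near: s; exact: lt_nbhsr.
    rewrite negb_and -!ltNge; apply/orP; left; near: s; exact: lt_nbhsl.
  near=> s; rewrite /= out//; first by near: s; exact: lt_nbhsr.
  rewrite negb_and -!ltNge; apply/orP; right; near: s; exact: lt_nbhsr.
exists L => // r s.
wlog rs : r s / r < s.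
  move=> H r0 s0; have [rs|sr|->] := ltgtP r s; first exact: H.
    by rewrite distrC [`|r - s|]distrC; exact: H.
  by rewrite !subrr normr0 mulr0.
move=> r0 s0; have ps z : r <= z -> 0 < z by exact: lt_le_trans.
have [||z /[!in_itv]/= /andP[rz _] zE] := @MVT R (phi \o ray) dphi r s rs.
- by move=> z /[!in_itv]/= /andP[/ltW/ps z0 _]; exact: is_derive_ray.
- apply: continuous_in_subspaceT => z; rewrite inE/= in_itv/= => /andP[/ps z0 _].
  by apply: C1c_continuous_ray; rewrite inE mem_posE.
rewrite distrC [`|r - s|]distrC (_ : phi (ray s) - phi (ray r) = dphi z * (s - r))//.
by rewrite normrM ler_wpM2r// dL// ps// ltW.
Unshelve. all: by end_near. Qed.

End C1c_ray.

(** * The kernel along the ray *)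

Section flux.
Context {R : realType} {d : nat}.
Local Notation mu := (@lebesgue_measure R).
Local Notation P := (`]0%R, +oo[%classic : set R).
Variables (gamma p c1 c2 : R) (K : 'rV[R]_d -> 'rV[R]_d -> R).
Hypothesis gamma_p : gamma + 2 * p < 1.
Hypotheses (c1_gt0 : 0 < c1) (c1_le_c2 : c1 <= c2).
Hypothesis K_cont : {within @Rdstar R d `*` @Rdstar R d,
  continuous (fun z : 'rV[R]_d * 'rV[R]_d => K z.1 z.2)}.
Hypothesis K_homog : forall (lambda : R) x y, 0 < lambda -> Rdstar x -> Rdstar y ->
  K (lambda *: x) (lambda *: y) = lambda `^ gamma * K x y.
Hypothesis K_bounds : forall x y, Rdstar x -> Rdstar y ->
  let n := l1norm x + l1norm y in
  let w := n `^ gamma * kernel_weight p (l1norm x / n) in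
  c1 * w <= K x y /\ K x y <= c2 * w.
Variable theta : 'rV[R]_d.
Hypothesis theta_simplex : simplex theta.
Variable C0 : R.
Hypothesis C0_gt0 : 0 < C0.
Local Notation ray := (ray theta).
Local Notation a := ((gamma + 3) / 2).

Let ray_R := ray_Rdstar theta_simplex.
Let theta_R : Rdstar theta := theta_simplex.1.

Definition ray_kernel (t : R) : R := K theta (ray t).

Lemma ray_kernelE r s : 0 < r -> 0 < s ->
  K (ray r) (ray s) = r `^ gamma * ray_kernel (s / r).
Proof.
move=> r0 s0; rewrite -K_homog ?divr_gt0//; last by apply: ray_R; rewrite divr_gt0.
by rewrite !rayE scalerA mulrC divfK// gt_eqF.
Qed.

(** At s = 1 / (1 + t) one has 1 - s = t / (1 + t), so each factor of the weight contributes (1 +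
    t)^p. *)
Let weightE t : 0 < t ->
  (1 + t) `^ gamma * kernel_weight p (1 / (1 + t)) =
  (1 + t) `^ (gamma + 2 * p) * t `^ (- p).
Proof.
move=> t0; have t10 : 0 < 1 + t by rewrite addr_gt0.
have invE : ((1 + t)^-1) `^ (- p) = (1 + t) `^ p.
  by rewrite -powR_inv1 ?(ltW t10)// -powRrM mulN1r opprK.
rewrite /kernel_weight (_ : 1 - 1 / (1 + t) = t * (1 + t)^-1); last by field; rewrite gt_eqF.
rewrite mul1r powRM ?invr_ge0 ?(ltW t0) ?(ltW t10)// invE.
by rewrite (_ : gamma + 2 * p = gamma + p + p) ?powRD_gt0//; ring.
Qed.

Let ray_kernel_bounds t : 0 < t ->
  c1 * ((1 + t) `^ (gamma + 2 * p) * t `^ (- p)) <= ray_kernel t /\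
  ray_kernel t <= c2 * ((1 + t) `^ (gamma + 2 * p) * t `^ (- p)).
Proof.
move=> t0; have /= := K_bounds theta_R (ray_R t0).
by rewrite l1norm_ray// theta_simplex.2 weightE.
Qed.

Lemma ray_kernel_gt0 t : 0 < t -> 0 < ray_kernel t.
Proof.
move=> t0; apply: lt_le_trans (ray_kernel_bounds t0).1.
by rewrite !mulr_gt0// powR_gt0// addr_gt0.
Qed.

Lemma ray_kernel_measurable : measurable_fun P ray_kernel.
Proof.
apply: continuous_in_pos_measurable.
apply: (within_continuous_comp_pos (h := fun t => (theta, ray t)) K_cont).
  move=> r _; apply: (@cvg_pair _ _ _ (nbhs r) (nbhs theta) (nbhs (ray r)) _ _ _ (fun=> theta) ray).
    exact: cvg_cst.
  exact: ray_continuous.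
by move=> r r0; split => //=; exact: ray_R.
Qed.

(** Joint measurability is obtained from [ray_kernel], a function of one variable, through
    homogeneity. *)
Let kernel_prod_measurable : measurable_fun (P `*` P) (fun z : R * R => K (ray z.1) (ray z.2)).
Proof.
have /eq_measurable_fun : {in P `*` P,
    (fun z : R * R => z.1 `^ gamma * ray_kernel (z.2 / z.1)) =1
    (fun z : R * R => K (ray z.1) (ray z.2))}.
  by move=> z /set_mem[]; rewrite !mem_posE => z1 z2; rewrite ray_kernelE.
by apply; exact: measurable_homogeneous_kernel ray_kernel_measurable.
Qed.

Let scaled_le k t : 0 <= k -> 0 < t ->
  k * ray_kernel t <= k * c2 * ((1 + t) `^ (gamma + 2 * p) * t `^ (- p)).
Proof. by move=> k0 t0; rewrite -mulrA ler_wpM2l//; exact: (ray_kernel_bounds t0).2. Qed.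

Let c2_ge0 : 0 <= c2. Proof. by rewrite (le_trans (ltW c1_gt0)). Qed.

Lemma ray_flux_constant_gt0_lty :
  (0 < flux_constant ray_kernel gamma < +oo)%E.
Proof.
have kt0 := ray_kernel_gt0; have mk := ray_kernel_measurable.
rewrite flux_constant_gt0//=.
apply: (flux_constant_lty (p := p) (c2 := c2)) => //; first by move=> t /kt0/ltW.
by move=> t t0; exact: (ray_kernel_bounds t0).2.
Qed.

Section stationary.
Variable f : {measure set (borel 'rV[R]_d) -> \bar R}.
Variable c : R.
Hypothesis c_ge0 : 0 < c.
Hypothesis f_radon : radon_on (@Rdstar R d) f.
Hypothesis f_ray : is_ray_measure ray (fun r => c * r `^ (- a)) f.
Local Open Scope ereal_scope.

Let w_meas : measurable_fun P (fun r => c * r `^ (- a))%R.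
Proof. by apply: measurable_funM => //; apply: measurable_funTS; exact: measurable_powR. Qed.

Let w_ge0 (r : R) : (0 < r -> 0 <= c * r `^ (- a))%R.
Proof. by move=> _; rewrite mulr_ge0 ?powR_ge0 ?(ltW c_ge0). Qed.

Lemma integral_ray (D : set (borel 'rV[R]_d)) (E : set R) (k : 'rV[R]_d -> \bar R) :
  measurable E -> P `&` ray @^-1` D = E -> measurable_fun E (k \o ray) ->
  \int[f]_(x in D) k x = \int[mu]_(r in E) (k (ray r) * (c * r `^ (- a))%:E).
Proof.
move=> mE ED mk; rewrite -ED in mE mk *.
apply: (integral_ray_measure (ray_continuous (theta := theta)) w_meas w_ge0 f_ray
  _ (@l1norm_continuous R d)) => //.
exact: l1norm_ray.
Qed.

Let rayR : P `&` ray @^-1` (@Rdstar R d) = P.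
Proof.
apply/seteqP; split=> r; first by move=> [].
by rewrite mem_posE => r0; split; [rewrite mem_posE|exact: ray_R].
Qed.

(** The exponents gamma + p - a and 1 - p - a are -1 minus and -1 plus (1 - gamma - 2p) / 2. *)
Lemma ray_moment_lty :
  \int[f]_(x in @Rdstar R d `&` [set x | (1 <= l1norm x)%R]) (l1norm x `^ (gamma + p))%:E +
  \int[f]_(x in @Rdstar R d `&` [set x | (l1norm x < 1)%R]) (l1norm x `^ (1 - p))%:E < +oo.
Proof.
have mp (E : set R) b : measurable_fun E (fun r => (l1norm (ray r) `^ b)%:E).
  apply/measurable_EFinP; apply: (eq_measurable_fun (fun r => r `^ b)%R).
    by move=> r _; rewrite l1norm_ray.
  by apply: measurable_funTS; exact: measurable_powR.
have mq (E : set R) b : measurable_fun E (fun r : R => (r `^ b)%:E).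
  by apply/measurable_EFinP; apply: measurable_funTS; exact: measurable_powR.
have q0 (b r : R) : 0 <= (r `^ b)%:E by rewrite lee_fin powR_ge0.
apply: lte_add_pinfty.
- rewrite (@integral_ray _ `[1%R, +oo[)//; last 2 first.
  + apply/seteqP; split=> r /=.
      by rewrite !in_itv/= !andbT l1norm_ray// => -[_ []].
    rewrite !in_itv/= !andbT l1norm_ray// => r1; have r0 : (0 < r)%R by exact: lt_le_trans r1.
    by split => //; split => //; exact: ray_R.
  + exact: mp.
  rewrite (_ : integral _ _ _ = \int[mu]_(r in `[1%R, +oo[) (c%:E * (r `^ (gamma + p - a))%:E)).
    rewrite ge0_integralZl_EFin ?(ltW c_ge0)//; last exact: mq.
    rewrite lte_mul_pinfty ?lee_fin ?(ltW c_ge0)//.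
    by apply: integral_powR1y_lty; move: gamma_p => gp; lra.
  apply: eq_integral => r /set_mem; rewrite /= in_itv/= andbT => r1.
  have r0 : (0 < r)%R by exact: lt_le_trans r1.
  by rewrite l1norm_ray// (powRD_gt0 (gamma + p))// -!EFinM; congr EFin; ring.
- rewrite (@integral_ray _ `]0%R, 1%R[)//; last 2 first.
  + apply/seteqP; split=> r /=.
      by rewrite !in_itv/= !andbT l1norm_ray// => -[-> []].
    rewrite !in_itv/= !andbT l1norm_ray// => /andP[r0 r1].
    by split => //; split => //; exact: ray_R.
  + exact: mp.
  rewrite (_ : integral _ _ _ = \int[mu]_(r in `]0%R, 1%R[) (c%:E * (r `^ (1 - p - a))%:E)).
    rewrite ge0_integralZl_EFin ?(ltW c_ge0)//; last exact: mq.
    rewrite lte_mul_pinfty ?lee_fin ?(ltW c_ge0)//.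
    apply: (@le_lt_trans _ _ (\int[mu]_(r in `]0%R, 1%R]) (r `^ (1 - p - a))%:E)).
      apply: ge0_subset_integral => //; first exact: mq.
      by move=> r /=; rewrite !in_itv/= => /andP[-> /ltW].
    by apply: integral_powR01_lty; move: gamma_p => gp; lra.
  apply: eq_integral => r /set_mem; rewrite /= in_itv/= => /andP[r0 _].
  by rewrite l1norm_ray// (powRD_gt0 (1 - p))// -!EFinM; congr EFin; ring.
Qed.

Section test_function.
Variable h : R -> R -> R.
Hypothesis h_meas : measurable_fun (P `*` P) (fun z => h z.1 z.2).
Variable X : 'rV[R]_d -> 'rV[R]_d -> R.
Hypothesis Xh : forall r s, (0 < r -> 0 < s -> X (ray r) (ray s) = h r s)%R.

(** A general factor [X] lets one formula serve both the absolute and the signed double integral.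
    The constants of the two densities are absorbed into the kernel as [c * c]. *)
Lemma integral_ray_ray :
  \int[f]_(x in @Rdstar R d) \int[f]_(y in @Rdstar R d) (K x y * X x y)%:E =
  \int[mu]_(r in P) \int[mu]_(s in P)
    (r `^ gamma * (c * c * ray_kernel (s / r)) * h r s * (s `^ (- a) * r `^ (- a)))%:E.
Proof.
have hm : measurable_fun (P `*` P) (fun z : R * R => (K (ray z.1) (ray z.2) * h z.1 z.2)%R).
  by apply: measurable_funM; [exact: kernel_prod_measurable|exact: h_meas].
have hw : measurable_fun (P `*` P) (fun z : R * R => (c * z.2 `^ (- a))%R).
  apply: measurable_funM => //; apply: measurable_funTS.
  exact: (measurableT_comp (measurable_powR _)).
have inner r : (0 < r)%R -> \int[f]_(y in @Rdstar R d) (K (ray r) y * X (ray r) y)%:E =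
    \int[mu]_(s in P) (K (ray r) (ray s) * h r s * (c * s `^ (- a)))%:E.
  move=> r0; rewrite (@integral_ray _ P)//.
    apply: eq_integral => s /set_mem; rewrite mem_posE => s0.
    by rewrite Xh// -EFinM.
  apply/measurable_EFinP; apply: (eq_measurable_fun (fun s => K (ray r) (ray s) * h r s)%R).
    by move=> s /set_mem; rewrite mem_posE => s0; rewrite Xh.
  apply/measurable_EFinP.
  apply: (@measurable_section_on _ _ _ _ _ P P _ _ (fun r s => (K (ray r) (ray s) * h r s)%:E)) => //.
  - exact/measurable_EFinP.
  - by rewrite mem_posE.
rewrite (@integral_ray _ P)//; last first.
  apply: (eq_measurable_fun (fun r => \int[mu]_(s in P) (K (ray r) (ray s) * h r s * (c * s `^ (- a)))%:E)).
    by move=> r /set_mem; rewrite mem_posE => r0; rewrite /= inner.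
  apply: (@measurable_integral_on _ _ _ _ _ mu P P (fun r s => (K (ray r) (ray s) * h r s * (c * s `^ (- a)))%:E)) => //.
  by apply/measurable_EFinP; exact: measurable_funM.
apply: eq_integral => r /set_mem; rewrite mem_posE => r0.
rewrite inner// muleC -gt0_integralZl//.
- apply: eq_integral => s /set_mem; rewrite mem_posE => s0.
  by rewrite -EFinM ray_kernelE//; congr EFin; ring.
- apply: (@measurable_section_on _ _ _ _ _ P P _ _ (fun r s => (K (ray r) (ray s) * h r s * (c * s `^ (- a)))%:E)) => //.
    by apply/measurable_EFinP; exact: measurable_funM.
  by rewrite mem_posE.
- by rewrite mulr_gt0// powR_gt0.
Qed.

End test_function.

Lemma ray_stationary (phi : 'rV[R]_d -> R) : C1c phi ->
  \int[f]_(x in @Rdstar R d) \int[f]_(y in @Rdstar R d)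
     (K x y * `|phi (x + y)%R - phi x - phi y|)%:E < +oo /\
  \int[f]_(x in @Rdstar R d) \int[f]_(y in @Rdstar R d)
     (K x y * (phi (x + y)%R - phi x - phi y))%:E = 0.
Proof.
move=> phiC.
have [m [M [m0 mM out]]] := C1c_ray_support theta_simplex phiC.
have [L L0 lip] := C1c_ray_lipschitz theta_simplex phiC.
(* Cut off to [P], where [phi] is known to be regular, [g] is measurable on all of R. *)
pose g := (phi \o ray) \_ P.
have gE r : (0 < r)%R -> g r = phi (ray r).
  by move=> r0; rewrite /g patchE mem_set// mem_posE.
have g_meas : measurable_fun setT g.
  apply/(measurable_restrictT _ _).1 => //; apply: continuous_in_pos_measurable.
  exact: C1c_continuous_ray.
have h_meas : measurable_fun (P `*` P) (fun z : R * R => g (z.1 + z.2) - g z.1 - g z.2)%R.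
  apply: measurable_funTS; apply: measurable_funB; last exact: measurableT_comp.
  apply: measurable_funB; last exact: measurableT_comp.
  by apply: measurableT_comp => //; exact: measurable_funD.
have Xh r s : (0 < r -> 0 < s ->
    phi (ray r + ray s) - phi (ray r) - phi (ray s) = g (r + s) - g r - g s)%R.
  by move=> r0 s0; rewrite !gE ?addr_gt0// !rayE -scalerDl.
have cc0 : (0 <= c * c)%R by rewrite mulr_ge0 ?(ltW c_ge0).
have [] := @stationary_ray R (fun t => c * c * ray_kernel t)%R gamma p (c * c * c2) _ _ _ gamma_p _
    g L m M g_meas L0 m0 mM _ _.
- by apply: measurable_funM => //; exact: ray_kernel_measurable.
- by move=> t t0; rewrite mulr_ge0// ltW// ray_kernel_gt0.
- by move=> t t0; exact: scaled_le.
- by rewrite mulr_ge0.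
- by move=> r r0 rmM; rewrite gE// out.
- by move=> r s r0 s0; rewrite !gE// lip.
move=> abs zero; split.
- rewrite (@integral_ray_ray (fun r s => `|g (r + s) - g r - g s|%R) _
    (fun x y => `|phi (x + y)%R - phi x - phi y|%R)); last 2 first.
  + exact: measurableT_comp.
  + by move=> r s r0 s0; rewrite Xh.
  apply: (le_lt_trans _ abs); rewrite le_eqVlt; apply/orP; left; apply/eqP.
  apply: eq_integral => r /set_mem; rewrite mem_posE => r0.
  apply: eq_integral => s /set_mem; rewrite mem_posE => s0.
  rewrite !normrM; congr (_%:E); congr (_ * _ * _)%R.
    by rewrite (ger0_norm (powR_ge0 _ _)) (gtr0_norm c_ge0) gtr0_norm// ray_kernel_gt0// divr_gt0.
  by rewrite !ger0_norm ?powR_ge0.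
- by rewrite (@integral_ray_ray (fun r s => g (r + s) - g r - g s)%R).
Qed.

End stationary.

(** * The polar representation and its flux *)

Section total_flux.
Hypothesis d_gt0 : (0 < d)%N.
Variable F : {measure set (borel (R * 'rV[R]_d)%type) -> \bar R}.
Local Notation b := ((gamma + 1) / 2 + d%:R).

Definition polar_ray (r : R) : R * 'rV[R]_d := (r, theta).

Lemma polar_ray_continuous : continuous polar_ray.
Proof.
move=> r; apply: (@cvg_pair _ _ _ (nbhs r) (nbhs r) (nbhs theta) _ _ _ id (fun=> theta)).
  exact: cvg_id.
exact: cvg_cst.
Qed.

Hypothesis F_ray : is_ray_measure polar_ray (fun r => C0 * r `^ (- b)) F.
Local Open Scope ereal_scope.

Let w_meas : measurable_fun P (fun r => C0 * r `^ (- b))%R.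
Proof. by apply: measurable_funM => //; apply: measurable_funTS; exact: measurable_powR. Qed.

Let w_ge0 (r : R) : (0 < r -> 0 <= C0 * r `^ (- b))%R.
Proof. by move=> _; rewrite mulr_ge0 ?powR_ge0 ?(ltW C0_gt0). Qed.

Lemma integral_polar_ray (D : set (borel (R * 'rV[R]_d)%type)) (E : set R)
    (k : R * 'rV[R]_d -> \bar R) :
  measurable E -> P `&` polar_ray @^-1` D = E -> measurable_fun E (k \o polar_ray) ->
  \int[F]_(x in D) k x = \int[mu]_(r in E) (k (r, theta) * (C0 * r `^ (- b))%:E).
Proof.
move=> mE ED mk; rewrite -ED in mE mk *.
apply: (integral_ray_measure polar_ray_continuous w_meas w_ge0 F_ray _ (lambda := fst)) => //.
by move=> z; exact: cvg_fst.
Qed.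

(** The radii occurring in a compact subset of the polar domain stay in some [m, M] with m > 0,
    where the density is continuous. *)
Lemma polar_ray_radon : radon_on (@polar_domain R d) F.
Proof.
have dom : P `<=` polar_ray @^-1` (@polar_domain R d) by move=> r; rewrite mem_posE.
have mfst : measurable_fun [set: borel (R * 'rV[R]_d)%type] (fst : borel (R * 'rV[R]_d)%type -> R).
  by apply: continuous_borel_fun => z; exact: cvg_fst.
have clP (C : set (R * 'rV[R]_d)) : compact C -> measurable (C : set (borel (R * 'rV[R]_d)%type)).
  by move=> cC; apply: closed_borel; apply: compact_closed => //; exact: norm_hausdorff.
have preE (A : set (borel (R * 'rV[R]_d)%type)) : measurable A ->
    measurable (P `&` polar_ray @^-1` A).
  move=> mA; apply: measurableI => //; rewrite -[X in measurable X]setTI.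
  exact: (continuous_into_borel polar_ray_continuous).
have domE : @polar_domain R d = (fst : borel (R * 'rV[R]_d)%type -> R) @^-1` P `&`
    (snd @^-1` @simplex R d).
  by apply/seteqP; split=> z; rewrite /polar_domain /= in_itv/= andbT.
have domM : measurable (@polar_domain R d : set (borel (R * 'rV[R]_d)%type)).
  rewrite domE; apply: measurableI.
    by rewrite -[X in measurable X]setTI; exact: mfst.
  apply: closed_borel; apply: closed_comp; last exact: closed_simplex.
  by move=> z _; exact: cvg_snd.
split.
  rewrite F_ray; last exact: measurableC.
  rewrite (_ : _ `&` _ = set0) ?integral_set0//.
  by apply/seteqP; split=> r //= -[/dom].
move=> C cC Cdom; rewrite F_ray; last exact: clP.
have cN : compact (fst @` C).
  by apply: continuous_compact => //; apply: continuous_subspaceT => z; exact: cvg_fst.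
have [|m [M [m0 mM CmM]]] := compact_pos_bounds cN.
  by move=> _ [z /Cdom[z0 _] <-]; rewrite mem_posE.
apply: (@le_lt_trans _ _ (\int[mu]_(r in `[m, M]) (C0 * r `^ (- b))%:E)).
  apply: ge0_subset_integral => //.
  - by apply: preE; exact: clP.
  - apply/measurable_EFinP; apply: measurable_funM => //.
    by apply: measurable_funTS; exact: measurable_powR.
  - by move=> r /=; rewrite in_itv/= => /andP[mr _]; rewrite lee_fin w_ge0// (lt_le_trans m0).
  - by move=> r [_ Cr]; apply: CmM; exists (polar_ray r).
rewrite ltey_eq integrable_fin_num//.
apply: continuous_compact_integrable; first exact: segment_compact.
apply: continuous_in_subspaceT => r; rewrite inE/= in_itv/= => /andP[mr _].
apply: (@continuousM R R (fun=> C0) (fun x : R => x `^ (- b)))%R; first exact: cst_continuous.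
by apply: powR_gt0_continuous; exact: lt_le_trans mr.
Qed.

(** Both sides become integrals of psi(r, theta), and the densities match because (d - 1) - b =
    -a. *)
Lemma polar_ray_representation (f : {measure set (borel 'rV[R]_d) -> \bar R}) :
  is_ray_measure ray (fun r => C0 / Num.sqrt d%:R * r `^ (- a))%R f ->
  polar_representation f F.
Proof.
move=> f_ray; split; first exact: polar_ray_radon.
move=> psi [psi_cont _].
have sd0 : (0 < Num.sqrt d%:R :> R)%R by rewrite sqrtr_gt0 ltr0n.
have psi_meas : measurable_fun P (fun r => psi (r, theta)).
  apply: continuous_in_pos_measurable.
  apply: (within_continuous_comp_pos (h := polar_ray) psi_cont).
    by move=> r _; exact: polar_ray_continuous.
  by move=> r r0; split.
rewrite (@integral_polar_ray _ P)//; last 2 first.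
- by apply/seteqP; split=> r; [move=> []|rewrite mem_posE => r0; split; rewrite ?mem_posE].
- apply/measurable_EFinP; apply: measurable_funM; first exact: psi_meas.
  by apply: measurable_funM => //; exact: exprn_measurable.
have rE r : (0 < r)%R -> (l1norm (ray r), (l1norm (ray r))^-1 *: ray r) = (r, theta).
  by move=> r0; rewrite l1norm_ray// rayE scalerA mulVf ?scale1r// gt_eqF.
rewrite (@integral_ray f (C0 / Num.sqrt d%:R) _ f_ray _ P)//; last 3 first.
- by rewrite divr_gt0.
- by apply/seteqP; split=> r; [move=> []|rewrite mem_posE => r0; split; [rewrite mem_posE|exact: ray_R]].
- apply/measurable_EFinP; apply: (eq_measurable_fun (fun r => psi (r, theta))) => // r /set_mem.
  by rewrite mem_posE => r0; rewrite /= rE.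
apply: eq_integral => r /set_mem; rewrite mem_posE => r0; rewrite rE// -!EFinM; congr EFin.
rewrite /= -powR_mulrn ?(ltW r0)//.
have dE : (d.-1%:R = d%:R - 1 :> R)%R by rewrite -{2}(prednK d_gt0) -natr1 addrK.
rewrite (_ : (- a = d.-1%:R + - b)%R) ?powRD_gt0//; first by ring.
by rewrite dE; field.
Qed.

(** Since r^d r^-b = r r^-a and s^(d - 1) s^-b = s^-a, the integral is that of [flux_ray] for the
    kernel theta_j C0^2 kappa. *)
Lemma total_flux_ray (rho : R) (j : 'I_d) : (0 < rho)%R ->
  total_flux K F rho j =
  (d%:R^-1)%:E * ((theta 0 j * C0 * C0)%:E * flux_constant ray_kernel gamma).
Proof.
move=> rho0; congr (_ * _).
have tj0 : (0 <= theta 0 j)%R by exact: theta_R.1.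
have k0 : (0 <= theta 0 j * C0 * C0)%R by rewrite !mulr_ge0 ?(ltW C0_gt0).
rewrite -flux_constantZ//; last 2 first.
- exact: ray_kernel_measurable.
- by move=> t t0; rewrite ltW// ray_kernel_gt0.
rewrite -(@flux_ray R (fun t => theta 0 j * C0 * C0 * ray_kernel t)%R gamma _ _ rho rho0); last 2 first.
- by apply: measurable_funM => //; exact: ray_kernel_measurable.
- by move=> t t0; rewrite mulr_ge0// ltW// ray_kernel_gt0.
pose I r s : R := (r ^+ d * s ^+ d.-1 * theta 0 j * K (ray r) (ray s))%R.
have I_meas : measurable_fun (P `*` P) (fun z : R * R => I z.1 z.2).
  apply: measurable_funM; last exact: kernel_prod_measurable.
  apply: measurable_funTS; apply: measurable_funM => //; apply: measurable_funM.
    exact: (measurableT_comp (exprn_measurable _)).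
  exact: (measurableT_comp (exprn_measurable _)).
have dE : (d.-1%:R = d%:R - 1 :> R)%R by rewrite -{2}(prednK d_gt0) -natr1 addrK.
have sub r : (r <= rho -> `](rho - r)%R, +oo[ `<=` P)%R.
  move=> rrho s /=; rewrite !in_itv/= !andbT; apply: le_lt_trans.
  by rewrite subr_ge0.
have I_sec r : (0 < r)%R -> (r <= rho)%R ->
    measurable_fun `](rho - r)%R, +oo[ (fun s => (I r s)%:E).
  move=> r0 rrho; apply: (measurable_funS (E := P)) => //; first exact: sub.
  apply: (@measurable_section_on _ _ _ _ _ P P _ _ (fun r s => (I r s)%:E)) => //.
    exact/measurable_EFinP.
  by rewrite mem_posE.
have inner r : (0 < r)%R -> (r <= rho)%R ->
    \int[F]_(w in [set w | (rho - r < w.1)%R /\ simplex w.2])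
      (r ^+ d * w.1 ^+ d.-1 * theta 0 j * K (r *: theta) (w.1 *: w.2))%:E =
    \int[mu]_(s in `](rho - r)%R, +oo[) ((I r s)%:E * (C0 * s `^ (- b))%:E).
  move=> r0 rrho; rewrite (@integral_polar_ray _ `](rho - r)%R, +oo[)//.
    apply/seteqP; split=> s.
      by move=> [_ [/= rs _]]; rewrite in_itv/= rs.
    move=> rs; split; first exact: (sub _ rrho).
    by move: rs; rewrite /= in_itv/= andbT.
  exact: I_sec.
rewrite (@integral_polar_ray _ `]0%R, rho])//; last 2 first.
- apply/seteqP; split=> r /=.
    by rewrite !in_itv/= andbT => -[-> [_ ->]].
  by rewrite !in_itv/= andbT => /andP[r0 rrho]; split.
- pose h (z : R * R) := (I z.1 z.2)%:E * (C0 * z.2 `^ (- b))%:E.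
  apply: (eq_measurable_fun (fun r => \int[mu]_(s in P) (h \_ (flux_domain rho)) (r, s))).
    move=> r /set_mem; rewrite /= in_itv/= => /andP[r0 rrho].
    by rewrite inner// -(integral_flux_section h).
  apply: (@measurable_funS _ _ _ _ P) => //; first by move=> r /=; rewrite !in_itv/= => /andP[->].
  apply: (@measurable_integral_on _ _ _ _ _ mu P P (fun r s => (h \_ (flux_domain rho)) (r, s))) => //.
  apply: (eq_measurable_fun (h \_ (flux_domain rho))); first by move=> [r s] _.
  apply/(measurable_restrict _ (flux_domain_measurable rho)); first exact: measurableX.
  apply: (@measurable_funS _ _ _ _ (P `*` P)) => //; first exact: measurableX.
  apply: emeasurable_funM; apply/measurable_EFinP; first exact: I_meas.
  apply: measurable_funM => //; apply: measurable_funTS.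
  exact: (measurableT_comp (measurable_powR _)).
apply: eq_integral => r /set_mem; rewrite /= in_itv/= => /andP[r0 rrho].
rewrite inner// muleC -ge0_integralZl_EFin ?w_ge0//; last 2 first.
- move=> s /(sub _ rrho); rewrite mem_posE => s0.
  rewrite -EFinM lee_fin !mulr_ge0 ?exprn_ge0 ?powR_ge0 ?(ltW r0) ?(ltW s0) ?(ltW C0_gt0)//.
  by rewrite ray_kernelE// mulr_ge0 ?powR_ge0// ltW// ray_kernel_gt0// divr_gt0.
- apply: emeasurable_funM; first exact: I_sec.
  by apply/measurable_EFinP; apply: measurable_funS w_meas => //; exact: sub.
apply: eq_integral => s /set_mem /(sub _ rrho); rewrite mem_posE => s0.
rewrite -!EFinM; congr EFin; rewrite /I ray_kernelE//.
rewrite -!powR_mulrn ?(ltW r0) ?(ltW s0)//.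
have -> : (s `^ (- a) = s `^ d.-1%:R * s `^ (- b))%R.
  by rewrite -powRD_gt0//; congr (_ `^ _)%R; rewrite dE; field.
have : (r `^ 1 * r `^ (- a) = r `^ d%:R * r `^ (- b))%R.
  by rewrite -!powRD_gt0//; congr (_ `^ _)%R; field.
rewrite powRr1 ?(ltW r0)// => rE.
transitivity (theta 0 j * C0 * C0 * ray_kernel (s / r) * r `^ gamma *
  (s `^ d.-1%:R * s `^ (- b)) * (r `^ d%:R * r `^ (- b)))%R.
  by ring.
by rewrite -rE; ring.
Qed.

End total_flux.
End flux.

Theorem mainTheorem5 (R : realType) (d : nat) (gamma p c1 c2 : R)
  (K : 'rV[R]_d -> 'rV[R]_d -> R)
  (d_ge1 : (1 <= d)%N)
  (gamma_p : gamma + 2 * p < 1)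
  (c1_gt0 : 0 < c1) (c1_le_c2 : c1 <= c2)
  (K_ge0 : forall x y, Rdstar x -> Rdstar y -> 0 <= K x y)
  (K_cont : {within @Rdstar R d `*` @Rdstar R d,
               continuous (fun z : 'rV[R]_d * 'rV[R]_d => K z.1 z.2)})
  (K_homog : forall (lambda : R) x y, 0 < lambda -> Rdstar x -> Rdstar y ->
     K (lambda *: x) (lambda *: y) = lambda `^ gamma * K x y)
  (K_bounds : forall x y, Rdstar x -> Rdstar y ->
     let n := l1norm x + l1norm y in
     let w := n `^ gamma * kernel_weight p (l1norm x / n) in
     c1 * w <= K x y /\ K x y <= c2 * w)
  (theta0 : 'rV[R]_d) (theta0_simplex : simplex theta0)
  (C0 : R) (C0_gt0 : 0 < C0)
  (f : {measure set (borel 'rV[R]_d) -> \bar R})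
  (f_radon : radon_on (@Rdstar R d) f)
  (f_ray : forall phi : 'rV[R]_d -> R, Cc_on (@Rdstar R d) phi ->
     (\int[f]_(x in @Rdstar R d) (phi x)%:E =
      (C0 / Num.sqrt d%:R)%:E *
      \int[lebesgue_measure]_(r in `]0%R, +oo[)
        (phi (r *: theta0) * r `^ (- ((gamma + 3) / 2)))%:E)%E) :
  constant_flux_solution K gamma p f.
Proof.
have c_gt0 : 0 < C0 / Num.sqrt d%:R by rewrite divr_gt0// sqrtr_gt0 ltr0n.
have f_rayE := is_ray_measure_unique theta0_simplex (ltW c_gt0) f_radon f_ray.
split.
  split; first exact: f_radon.
    exact: (ray_moment_lty gamma_p theta0_simplex c_gt0 f_rayE).
  move=> phi phiC.
  have [abs zero] := ray_stationary gamma_p c1_gt0 c1_le_c2 K_cont K_homog K_bounds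
    theta0_simplex c_gt0 f_rayE phiC.
  by split => //; rewrite zero mule0.
(* The Dirac mass in the angle is realised by the curve r -> (r, theta0), with density C0 r^-b. *)
pose b := (gamma + 1) / 2 + d%:R.
have [||F F_ray] := @ray_measure_exists R (R * 'rV[R]_d)%type (polar_ray theta0)
    (fun r => C0 * r `^ (- b)) (polar_ray_continuous (theta := theta0)).
- by apply: measurable_funM => //; apply: measurable_funTS; exact: measurable_powR.
- by move=> r _; rewrite mulr_ge0 ?powR_ge0 ?ltW.
exists F; split; first exact: (polar_ray_representation theta0_simplex C0_gt0 d_ge1 F_ray f_rayE).
have /andP[flux_gt0 flux_lty] := ray_flux_constant_gt0_lty gamma_p c1_gt0 c1_le_c2
  K_cont K_bounds theta0_simplex.
(* The flux vector is J theta0. The flux constant is finite, so [fine] keeps its value, and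
   positive, so J theta0 lies in [Rdstar]. *)
pose J : R := d%:R^-1 * (C0 * C0 * fine (flux_constant (ray_kernel K theta0) gamma)).
have J_gt0 : 0 < J.
  rewrite !mulr_gt0 ?invr_gt0 ?ltr0n//.
  by rewrite fine_gt0// flux_gt0.
exists (J *: theta0); first by apply: RdstarZ => //; exact: theta0_simplex.1.
move=> rho rho_gt0 j.
rewrite (total_flux_ray c1_gt0 K_cont K_homog K_bounds theta0_simplex C0_gt0 d_ge1 F_ray)//.
rewrite -[flux_constant _ _]fineK ?ge0_fin_numE ?(ltW flux_gt0)//.
by rewrite -!EFinM mxE /J; congr EFin; ring.
Qed.
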